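(* Let $m_0$ and $m$ be natural numbers with $m\ge m_0$, and let $f\in C^{2m-}$. Suppose that $$f^{(2m_0-1)}(x)\to0\quad\text{as }x\to\infty$$ and that the series $$\sum_{k=0}^\infty f^{(2m)}(k+w)\ \text{ converges uniformly in } w\in[-m/2,m/2].$$ Let $F$ be any antiderivative of $f$, so that $F'=f$. Then the following limit exists and $$\sum_{k\ge0}^{\mathrm{Alt}}f(k):=\lim_{n\to\infty}\Big(\sum_{k=0}^{n-1}f(k)-G_{m_0,F}(n)\Big)=-G_{m,F}(0)-R_{m,f}(\infty),$$ where $$G_{m,F}(n):=\sum_{j=1}^m\gamma_{m,j}\sum_{i=0}^{j-1}F(n-1+j/2-i)=\sum_{\alpha=1-m}^{m-1}\tau_{m,1+|\alpha|}\,F(n-1/2-\alpha/2)$$ $$=\tau_{m,1}F(n-1/2)+\sum_{\alpha=1}^{m-1}\tau_{m,1+\alpha}\big[F(n-1/2-\alpha/2)+F(n-1/2+\alpha/2)\big]$$ (and $G_{m_0,F}$ is given by the same formula with $m_0$ in place of $m$), and $$R_{m,f}(\infty):=\frac1{(2m-1)!\,2^{2m+1}}\int_0^1 ds\,(1-s)^{2m-1}\int_{-1}^{1}dv\,v^{2m}\sum_{j=1}^m\gamma_{m,j}\,j^{2m+1}\sum_{k=0}^{\infty}f^{(2m)}(k+jsv/2).$$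
   Context: For a natural number $\alpha$, $C^{\alpha-}$ denotes the set of all functions $f:\mathbb R\to\mathbb R$ having continuous derivatives $f^{(i)}$ of all orders $i=0,\dots,\alpha-1$ and such that $f^{(\alpha-1)}$ is absolutely continuous, with a Radon–Nikodym derivative denoted by $f^{(\alpha)}$. $\gamma_{m,j}:=(-1)^{j-1}\,\frac2j\,\binom{2m}{m+j}\big/\binom{2m}{m}$ for $j\ge1$, and $\tau_{m,r}:=\sum_{\beta=0}^{\lfloor m/2-r/2\rfloor}\gamma_{m,r+2\beta}$ for $r\ge1$. The sum of an empty family is $0$. *)

(* Defs.v *)
From HB Require Import structures.
From mathcomp Require Import all_boot all_order all_algebra.
From mathcomp Require Import all_classical all_reals all_analysis.

Set Implicit Arguments.
Unset Strict Implicit.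
Unset Printing Implicit Defensive.

Import Order.TTheory GRing.Theory Num.Theory.
Import numFieldNormedType.Exports.

Local Open Scope classical_set_scope.
Local Open Scope ring_scope.

(* Absolute continuity on every compact interval (the epsilon-delta condition);
   a function on the whole line is called absolutely continuous when this
   holds. *)
Definition abs_continuous (R : realType) (h : R -> R) : Prop :=
  forall a b : R, forall eps : R, 0 < eps ->
  exists2 delta : R, 0 < delta &
    forall (n : nat) (u v : 'I_n -> R),
      (forall i, a <= u i /\ u i <= v i /\ v i <= b) ->
      trivIset [set: 'I_n] (fun i => `]u i, v i[%classic) ->
      \sum_(i < n) (v i - u i) < delta ->
      \sum_(i < n) `|h (v i) - h (u i)| < eps.

(* Such a g is determined only up to a Lebesgue-null set. *)
Definition is_Radon_Nikodym_derivative (R : realType) (h g : R -> R) : Prop :=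
  forall a b : R, a <= b ->
    (@lebesgue_measure R).-integrable `[a, b] (EFin \o g) /\
    (\int[@lebesgue_measure R]_(x in `[a, b]) g x = h b - h a)%R.

(* The class C^{alpha-}, for alpha >= 1. The library's iterated derivative is a
   total function, so the existence of the derivatives of orders up to
   alpha - 1 has to be required explicitly. *)
Definition C_minus (R : realType) (alpha : nat) (f : R -> R) : Prop :=
  [/\ forall i : nat, (i.+1 < alpha)%N -> forall x : R, derivable (derive1n i f) x 1,
      forall i : nat, (i < alpha)%N -> continuous (derive1n i f)
    & abs_continuous (derive1n alpha.-1 f)].

Definition gamma_coef (R : realType) (m j : nat) : R :=
  (-1) ^+ j.-1 * (2 / j%:R) * ('C(2 * m, m + j)%:R / 'C(2 * m, m)%:R).

(* (m.+2 - r)./2, with truncated subtraction, is the number of integers beta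
   with 0 <= beta <= floor (m/2 - r/2); it is 0 as soon as r > m. *)
Definition tau_coef (R : realType) (m r : nat) : R :=
  \sum_(0 <= beta < (m.+2 - r)./2) gamma_coef R m (r + 2 * beta).

Definition G (R : realType) (m : nat) (F : R -> R) (n : nat) : R :=
  \sum_(1 <= j < m.+1) gamma_coef R m j *
    \sum_(0 <= i < j) F (n%:R - 1 + j%:R / 2 - i%:R).

(* The sum over the integers alpha from 1 - m to m - 1, for m >= 1, with
   alpha = i - (m - 1) for i = 0, ..., 2m - 2. *)
Definition G_tau (R : realType) (m : nat) (F : R -> R) (n : nat) : R :=
  \sum_(0 <= i < (2 * m).-1)
    let alpha : int := i%:Z - (m.-1)%:Z in
    tau_coef R m (1 + `|alpha|%N) * F (n%:R - 1 / 2 - alpha%:~R / 2).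

Definition G_tau_sym (R : realType) (m : nat) (F : R -> R) (n : nat) : R :=
  tau_coef R m 1 * F (n%:R - 1 / 2) +
  \sum_(1 <= alpha < m) tau_coef R m (1 + alpha) *
    (F (n%:R - 1 / 2 - alpha%:R / 2) + F (n%:R - 1 / 2 + alpha%:R / 2)).

(* g stands for the derivative f^{(2m)} of f in C^{2m-}. *)
Definition remainder_infty (R : realType) (m : nat) (g : R -> R) : R :=
  1 / (((2 * m).-1)`!%:R * 2 ^+ (2 * m).+1) *
  (\int[@lebesgue_measure R]_(s in `[0, 1]) ((1 - s) ^+ (2 * m).-1 *
    \int[@lebesgue_measure R]_(v in `[-1, 1]) (v ^+ (2 * m) *
      \sum_(1 <= j < m.+1) (gamma_coef R m j * j%:R ^+ (2 * m).+1 *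
        limn (series (fun k : nat => g (k%:R + j%:R * s * v / 2)))))))%R.

Definition alt_partial_sum (R : realType) (m0 : nat) (f F : R -> R) (n : nat)
    : R :=
  \sum_(0 <= k < n) f k%:R - G m0 F n.

Definition alt_sum (R : realType) (m0 : nat) (f F : R -> R) : R :=
  limn (alt_partial_sum m0 f F).

(* Main.v *)
Require Import Defs.
From HB Require Import structures.
From mathcomp Require Import all_boot all_order all_algebra.
From mathcomp Require Import all_classical all_reals all_analysis.
From mathcomp Require Import measurable_realfun.
From mathcomp Require Import ring lra zify.

Set Implicit Arguments.
Unset Strict Implicit.
Unset Printing Implicit Defensive.

Import Order.TTheory GRing.Theory Num.Theory.
Import numFieldNormedType.Exports.

Local Open Scope classical_set_scope.
Local Open Scope ring_scope.

(* Taylor's formula at 0 with integral remainder, integrated over [-j/2, j/2]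
   and combined with the weights gamma_coef m j, gives
     phi 0 = sum_j gamma_j (F (j/2) - F (-j/2)) - remainder
   because sum_j gamma_j j ^ (2l+1) = [l = 0] for l < m: all the other
   derivatives at 0 cancel.  Applied to phi x = sum_(k < K) f (k + x), the
   first term telescopes to G m F K - G m F 0, and the remainder passes to the
   limit K -> oo by uniform convergence of the sums of f2m.  Finally
   G m F K - G m0 F K -> 0: both are weighted sums of values of F around
   K - 1/2 with the same moments of order < 2 m0, so only Taylor remainders
   involving the derivative of f of order 2 m0 - 1 survive. *)

(** [f2m] is known only through its integrals over compact intervals: neither continuity nor
    boundedness, nor any pointwise relation to the derivative of order 2m - 1, is available. This
    shapes the proof in three ways. At the top order, integration by parts cannot use the product
    rule; it is Fubini's theorem on a triangle. Taylor's formula needs the integral over s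
    innermost, whereas the remainder in the statement has the integral over v innermost; to exchange
    them, the double integral of a possibly unbounded function must first be shown to converge
    absolutely. Finally, changes of variable and Fubini are used on the whole line and plane, while
    [f2m] is only locally integrable and its sums converge only on [-m/2, m/2]; so functions are cut
    off to 0 outside that interval, which contains every point j s v / 2 that occurs. *)

(** * Odd moments of the weights [gamma_coef] *)

(** An n-th finite difference kills polynomials of degree below n. Pascal's rule turns order n + 1
    into order n applied to a first difference, and the first difference of a p-th power contains
    only powers below p. The shift x lets the sum be centred later at the middle binomial
    coefficient. *)
Lemma alt_binomial_pow_sum (R : comNzRingType) (n p : nat) (x : R) : (p < n)%N ->
  \sum_(i < n.+1) (-1) ^+ i * 'C(n, i)%:R * (x + i%:R) ^+ p = 0.
Proof.
elim: n p x => [//|n IH] p x pn.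
have -> : \sum_(i < n.+2) (-1) ^+ i * 'C(n.+1, i)%:R * (x + i%:R) ^+ p =
    \sum_(i < n.+1) (-1) ^+ i * 'C(n, i)%:R *
      ((x + i%:R) ^+ p - (x + i%:R + 1) ^+ p).
  rewrite big_ord_recl/= bin0.
  under eq_bigr => i _.
    rewrite /bump/= add1n binS natrD mulrDr mulrDl; over.
  rewrite big_split/= addrA.
  have -> : (-1) ^+ 0 * 1%:R * (x + 0%:R) ^+ p +
     \sum_(i < n.+1) (-1) ^+ i.+1 * 'C(n, i.+1)%:R * (x + i.+1%:R) ^+ p =
     \sum_(i < n.+1) (-1) ^+ i * 'C(n, i)%:R * (x + i%:R) ^+ p.
    rewrite [RHS]big_ord_recl/= bin0; congr (_ + _).
    rewrite big_ord_recr/= bin_small// mulr0 mul0r addr0.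
    by apply: eq_bigr => i _; rewrite /bump/= add1n.
  rewrite -big_split/=; apply: eq_bigr => i _.
  by rewrite exprS -natr1 addrA; ring.
have H (i : 'I_n.+1) : (x + i%:R) ^+ p - (x + i%:R + 1) ^+ p =
    - \sum_(k < p) 'C(p, k)%:R * (x + i%:R) ^+ k.
  rewrite [_ + 1]addrC [(1 + _) ^+ p]exprDn big_ord_recr/= binn mulr1n subnn.
  rewrite expr0 mul1r. rewrite opprD addrCA subrr addr0; congr (- _).
  by apply: eq_bigr => k _; rewrite expr1n mul1r mulr_natl.
under eq_bigr => i _ do rewrite H mulrN mulr_sumr.
rewrite sumrN exchange_big/= big1 ?oppr0// => k _.
under eq_bigr => i _ do rewrite mulrCA.
rewrite -mulr_sumr IH ?mulr0//.
exact: leq_trans (ltn_ord k) _.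
Qed.

(** The factor 2 / j in [gamma_coef] leaves the even power j ^ (2l). In the vanishing 2m-th
    difference of x ^ (2l) started at x = -m, the indices m - j and m + j contribute equally, so
    twice the sum over j >= 1 is minus the middle term, which is nonzero only for l = 0. *)
Lemma gamma_moment (R : realType) (m l : nat) : (l < m)%N ->
  \sum_(1 <= j < m.+1) gamma_coef R m j * j%:R ^+ (2 * l).+1 = (l == 0)%:R.
Proof.
move=> lm.
have c0 : ('C(2 * m, m)%:R : R) != 0.
  by rewrite pnatr_eq0 -lt0n bin_gt0 leq_pmull.
pose t j : R := (-1) ^+ j * 'C(2 * m, m + j)%:R * j%:R ^+ (2 * l).
have tE : \sum_(1 <= j < m.+1) gamma_coef R m j * j%:R ^+ (2 * l).+1 =
    - (2 / 'C(2 * m, m)%:R) * \sum_(1 <= j < m.+1) t j.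
  rewrite mulr_sumr big_nat [RHS]big_nat; apply: eq_bigr => j /andP[j1 _].
  have j0 : (j%:R : R) != 0 by rewrite pnatr_eq0 -lt0n.
  rewrite /gamma_coef /t; case: j j1 j0 => [|j _ j0]; first by [].
  rewrite [LHS]/= [in LHS]exprSr [in RHS]exprS.
  move: (j.+1%:R : R) ('C(2 * m, m)%:R : R) j0 c0 => y c y0 c0.
  by field; rewrite c0 y0.
have := @alt_binomial_pow_sum R (2 * m) (2 * l) (- m%:R) ltac:(lia).
rewrite -(big_mkord xpredT (fun i => (-1) ^+ i * 'C(2 * m, i)%:R *
  (- m%:R + i%:R) ^+ (2 * l))) (@big_cat_nat _ _ _ m)//=; last lia.
rewrite [X in _ + X]big_ltn; last lia.
have -> : \sum_(0 <= i < m) (-1) ^+ i * 'C(2 * m, i)%:R * (- m%:R + i%:R) ^+ (2 * l)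
   = (-1) ^+ m * \sum_(1 <= j < m.+1) t j :> R.
  rewrite mulr_sumr big_add1/= big_nat_rev/= big_nat [RHS]big_nat.
  apply: eq_bigr => i /andP[_ im]; rewrite /t add0n.
  have -> : (- m%:R + (m - i.+1)%:R : R) = - i.+1%:R by rewrite natrB//; ring.
  rewrite exprM sqrrN -exprM !mulrA -exprD -(@bin_sub _ (m + i.+1)); last lia.
  have -> : (2 * m - (m + i.+1) = m - i.+1)%N by lia.
  by rewrite -signr_odd -[in RHS]signr_odd oddB// oddD.
have -> : \sum_(m.+1 <= i < (2 * m).+1) (-1) ^+ i * 'C(2 * m, i)%:R * (- m%:R + i%:R) ^+ (2 * l)
   = (-1) ^+ m * \sum_(1 <= j < m.+1) t j :> R.
  rewrite mulr_sumr -{1}(addn1 m) addnC.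
  have -> : ((2 * m).+1 = m.+1 + m)%N by lia.
  rewrite big_addn addnK; apply: eq_bigr => i _; rewrite /t.
  by rewrite mulrnDr addrCA addNr addr0 [(i + m)%N]addnC exprD !mulrA.
rewrite addNr tE => H.
have {H} : 2 * \sum_(1 <= j < m.+1) t j + 'C(2 * m, m)%:R * 0 ^+ (2 * l) = 0.
  apply: (@mulfI _ ((-1) ^+ m : R)); first by rewrite signr_eq0.
  by rewrite mulr0 -[RHS]H; ring.
move=> /eqP; rewrite addr_eq0 => /eqP H.
rewrite mulNr mulrAC H mulNr opprK mulrAC divff// mul1r.
by rewrite expr0n muln_eq0.
Qed.

(** * Regrouping double sums over half-integer nodes *)

Lemma sum_symmetric_int (V : zmodType) (H : int -> V) (m : nat) :
  \sum_(0 <= i < (2 * m.+1).-1) H (i%:Z - m%:Z) =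
  H 0 + \sum_(1 <= a < m.+1) (H a%:Z + H (- a%:Z)).
Proof.
elim: m => [|m IH].
  by rewrite muln1/= big_nat1 big_geq// subrr addr0.
have -> : ((2 * m.+2).-1 = (2 * m.+1).-1.+2)%N by lia.
rewrite big_nat_recl// big_nat_recr//=.
have -> : \sum_(0 <= i < (2 * m.+1).-1) H (i.+1%:Z - m.+1%:Z) =
    \sum_(0 <= i < (2 * m.+1).-1) H (i%:Z - m%:Z).
  by apply: eq_bigr => i _; congr H; lia.
have -> : (0%:Z - m.+1%:Z = - m.+1%:Z) by lia.
have -> : ((2 * m.+1).-1.+1%:Z - m.+1%:Z = m.+1%:Z) by lia.
rewrite IH [in RHS]big_nat_recr//= [RHS]addrA.
by rewrite [LHS]addrC -[LHS]addrA.
Qed.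

Lemma sum_step2_int (V : zmodType) (H : int -> V) (m : nat) :
  \sum_(0 <= i < m.+1) H ((2 * i)%:Z - m%:Z) =
  (if odd m then 0 else H 0) +
  \sum_(1 <= a < m.+1 | odd a == odd m) (H a%:Z + H (- a%:Z)).
Proof.
elim/ltn_ind: m => -[|[|m]] IH.
- by rewrite big_nat1 big_geq//= subrr addr0.
- rewrite big_nat_recr//= big_nat1 big_mkcond big_nat1/= add0r addrC.
  by rewrite add0r.
rewrite big_nat_recl// big_nat_recr//=.
have -> : \sum_(0 <= i < m.+1) H ((2 * i.+1)%:Z - m.+2%:Z) =
    \sum_(0 <= i < m.+1) H ((2 * i)%:Z - m%:Z).
  by apply: eq_bigr => i _; congr H; lia.
have -> : ((2 * 0)%:Z - m.+2%:Z = - m.+2%:Z) by lia.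
have -> : ((2 * m.+2)%:Z - m.+2%:Z = m.+2%:Z) by lia.
rewrite IH; last lia.
rewrite negbK [in RHS]big_mkcond/= 2?[in RHS]big_nat_recr//= -big_mkcond/=.
rewrite negbK eqxx [if ~~ odd m == odd m then _ else _](_ : _ = 0).
  by rewrite addr0 [LHS]addrC -[LHS]addrA [RHS]addrA.
by case: (odd m).
Qed.

(** Recursion in m for the sum in [tau_coef]: its indices go up from r by steps of 2 without
    exceeding m, so m + 1 adds a term only if it has the parity of r. *)
Lemma stride2_sumS (V : zmodType) (c : nat -> V) (m r : nat) :
  \sum_(0 <= b < (m.+3 - r)./2) c (r + 2 * b)%N =
  \sum_(0 <= b < (m.+2 - r)./2) c (r + 2 * b)%N +
  (if (r <= m.+1)%N && (odd r == odd m.+1) then c m.+1 else 0).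
Proof.
case: ifPn => [/andP[rm /eqP orm]|].
  have -> : ((m.+3 - r)./2 = (m.+2 - r)./2.+1)%N by lia.
  rewrite big_nat_recr//=; congr (_ + c _).
  by lia.
rewrite addr0 => h.
by have -> : ((m.+3 - r)./2 = (m.+2 - r)./2)%N by lia.
Qed.

(** The origin of [tau_coef]: it collects the weights of all j whose nodes include a given point.
    The weights [c] are arbitrary because the induction moves only the upper bound of j, while in
    [gamma_coef R m j] the same m also occurs inside the weight. *)
Lemma sum_step2_regroup (R : realType) (c : nat -> R) (H : int -> R) (m : nat) :
  \sum_(1 <= j < m.+1) c j * \sum_(0 <= i < j) H ((2 * i)%:Z - j.-1%:Z) =
  (\sum_(0 <= b < m.+1./2) c (1 + 2 * b)%N) * H 0 +
  \sum_(1 <= a < m) (\sum_(0 <= b < (m.+1 - a)./2) c (1 + a + 2 * b)%N) *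
    (H a%:Z + H (- a%:Z)).
Proof.
elim: m => [|m IH]; first by rewrite !big_geq// ?mul0r ?addr0.
rewrite big_nat_recr//= IH.
rewrite sum_step2_int.
have E a : \sum_(0 <= b < (m.+2 - a)./2) c (1 + a + 2 * b)%N =
   \sum_(0 <= b < (m.+1 - a)./2) c (1 + a + 2 * b)%N +
   (if (a <= m)%N && (odd a == odd m) then c m.+1 else 0).
  have := stride2_sumS c m a.+1; rewrite !subSS => ->; congr (_ + _).
  by rewrite ltnS/= (inj_eq negb_inj).
have -> : \sum_(0 <= i < m.+2./2) c (1 + 2 * i)%N =
  \sum_(0 <= i < m.+1./2) c (1 + 2 * i)%N + (if odd m then 0 else c m.+1).
  have := E 0; rewrite !subn0 => ->.
  by congr (_ + _); case: (odd m).
under [in RHS]eq_bigr => a _ do rewrite E mulrDl.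
rewrite [in RHS]big_split/=.
have -> : \sum_(1 <= i < m.+1) (\sum_(0 <= b < (m.+1 - i)./2) c (1 + i + 2 * b)%N) *
    (H i%:Z + H (- i%:Z)) =
  \sum_(1 <= i < m) (\sum_(0 <= b < (m.+1 - i)./2) c (1 + i + 2 * b)%N) *
    (H i%:Z + H (- i%:Z)).
  case: m {IH E} => [|m]; first by rewrite !big_geq.
  by rewrite big_nat_recr//= subSnn/= [X in _ + X * _]big_geq// mul0r addr0.
have -> : \sum_(1 <= i < m.+1) (if (i <= m)%N && (odd i == odd m) then c m.+1 else 0) *
    (H i%:Z + H (- i%:Z)) =
   c m.+1 * \sum_(1 <= a < m.+1 | odd a == odd m) (H a%:Z + H (- a%:Z)).
  rewrite [in RHS]big_mkcond mulr_sumr big_nat [RHS]big_nat.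
  apply: eq_bigr => i /andP[_]; rewrite ltnS => ->/=.
  by case: ifP; rewrite ?mul0r ?mulr0.
by case: (odd m); ring.
Qed.

(** * Forms, forward difference and moments of [G] *)

Section midpoint_sums.
Context {R : realType}.
Implicit Types (m n p : nat) (F : R -> R).

Lemma G_tau_symE m F n : G m F n = G_tau_sym m F n.
Proof.
(* The node n - 1 + j/2 - i is n - 1/2 - a/2 with a = 2 i - (j - 1). *)
pose H (a : int) := F (n%:R - 1 / 2 - a%:~R / 2).
have -> : G m F n = \sum_(1 <= j < m.+1) gamma_coef R m j *
    \sum_(0 <= i < j) H ((2 * i)%:Z - j.-1%:Z).
  rewrite /G big_nat [RHS]big_nat; apply: eq_bigr => -[//|j] _.
  congr (_ * _); apply: eq_bigr => i _; congr F.
  by rewrite /= rmorphB/= PoszM rmorphM/= -!pmulrn -natr1; field.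
rewrite sum_step2_regroup /G_tau_sym /H.
rewrite /tau_coef subn1; congr (_ + _); first by rewrite mulr0z mul0r subr0.
apply: eq_bigr => a _; rewrite subSS; congr (_ * (_ + F _)).
by rewrite mulrNz mulNr opprK.
Qed.

Lemma G_tauE m F n : (0 < m)%N -> G m F n = G_tau m F n.
Proof.
case: m => // m _; rewrite G_tau_symE /G_tau_sym /G_tau /=.
pose H (a : int) := tau_coef R m.+1 (1 + `|a|%N) * F (n%:R - 1 / 2 - a%:~R / 2).
rewrite (sum_symmetric_int H) /H mulr0z mul0r subr0; congr (_ + _).
apply: eq_bigr => a _; rewrite abszN mulrDr mulrNz mulNr opprK.
by [].
Qed.

(** For each j the j nodes are spaced by 1, so passing from n to n + 1 only exchanges one end node
    for another. Thus [G m F] is a summation antiderivative of weighted integrals of F' over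
    [n - j/2, n + j/2]. *)
Lemma G_step m F n : G m F n.+1 - G m F n =
  \sum_(1 <= j < m.+1) gamma_coef R m j *
    (F (n%:R + j%:R / 2) - F (n%:R - j%:R / 2)).
Proof.
rewrite /G -sumrB; apply: eq_bigr => j _; rewrite -mulrBr; congr (_ * _).
rewrite -sumrB; pose u i := - F (n%:R + j%:R / 2 - i%:R).
rewrite (eq_bigr (fun i => u i.+1 - u i)) => [|i _].
  rewrite telescope_sumr// /u subr0 opprK addrC.
  by congr (F _ - F _); field.
rewrite /u opprK addrC; congr (- F _ + F _).
  by rewrite -[i.+1%:R]natr1; ring.
by rewrite -natr1; ring.
Qed.

(** The p-th moment about n - 1/2 of the weights with which [G m] samples F. It does not involve n,
    since the nodes move along with n. *)
Definition central_moment m p : R :=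
  \sum_(1 <= j < m.+1) gamma_coef R m j *
    \sum_(0 <= i < j) (j%:R / 2 - 1 / 2 - i%:R) ^+ p.

(** For odd p the two even powers cancel; for p = 2 l they add up, and [gamma_moment] applies. *)
Lemma gamma_odd_difference m p : (p < 2 * m)%N ->
  \sum_(1 <= j < m.+1) gamma_coef R m j *
    ((j%:R / 2) ^+ p.+1 - (- (j%:R / 2)) ^+ p.+1) = (p == 0)%:R.
Proof.
move=> pm.
rewrite (eq_bigr (fun j => 2^-1 ^+ p.+1 * (1 - (-1) ^+ p.+1) *
    (gamma_coef R m j * j%:R ^+ p.+1))) => [|j _]; last first.
  by rewrite [(- (_ / _)) ^+ _]exprNn exprMn; ring.
rewrite -mulr_sumr.
have [op|ep] := boolP (odd p).
  rewrite -signr_odd/= op subrr mulr0 mul0r.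
  by case: p op {pm}.
have -> : p = (2 * p./2)%N by lia.
rewrite gamma_moment; last lia.
rewrite -signr_odd/= mul2n odd_double/= double_eq0.
case: (p./2 == 0) / eqP => [->|_]; last by rewrite mulr0.
by rewrite expr1; field.
Qed.

(* Applying the weights to the central difference of x ^+ p.+1 telescopes to a
   moment of gamma_coef, which does not depend on m. *)
Lemma central_moment_rec m p : (p < 2 * m)%N ->
  \sum_(k < p.+1) (2^-1 ^+ (p.+1 - k) - (- 2^-1) ^+ (p.+1 - k)) *
    central_moment m k *+ 'C(p.+1, k) = (p == 0)%:R.
Proof.
move=> pm; rewrite -(gamma_odd_difference pm).
pose x (j i : nat) : R := j%:R / 2 - 1 / 2 - i%:R.
under eq_bigr => k _ do rewrite -mulrnAl mulr_sumr.
rewrite exchange_big/=; apply: eq_bigr => j _.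
under eq_bigr => k _ do rewrite mulrCA mulr_sumr.
rewrite -mulr_sumr exchange_big/=; congr (_ * _).
transitivity (\sum_(0 <= i < j)
    ((2^-1 + x j i) ^+ p.+1 - (- 2^-1 + x j i) ^+ p.+1)).
  apply: eq_bigr => i _.
  rewrite 2!exprDn 2![\sum_(i0 < p.+2) _]big_ord_recr/= !subnn !expr0 opprD.
  rewrite addrACA subrr addr0 -sumrB.
  by apply: eq_bigr => k _; rewrite -[RHS]mulrnBl -[in RHS]mulrBl -mulrnAl.
pose u i : R := - (j%:R / 2 - i%:R) ^+ p.+1.
rewrite (eq_bigr (fun i => u i.+1 - u i)) => [|i _]; last first.
  rewrite /u opprK addrC; congr (- _ ^+ _ + _ ^+ _); rewrite /x; last by field.
  by rewrite -natr1; field.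
rewrite telescope_sumr// /u subr0 opprK addrC.
by have -> : j%:R / 2 - j%:R = - (j%:R / 2) :> R by field.
Qed.

(** In [central_moment_rec] the right-hand side is free of m and the top term k = p has coefficient
    (1/2 + 1/2) (p + 1), which is nonzero. The recurrence therefore determines the moments one after
    the other. *)
Lemma central_moment_indep m m' p : (p < 2 * m)%N -> (p < 2 * m')%N ->
  central_moment m p = central_moment m' p.
Proof.
elim/ltn_ind: p => p IH pm pm'.
have := central_moment_rec pm; rewrite -(central_moment_rec pm').
rewrite !big_ord_recr/= subSnn !expr1 !opprK.
rewrite (eq_bigr (fun k : 'I_p => (2^-1 ^+ (p.+1 - k) - (- 2^-1) ^+ (p.+1 - k)) *
    central_moment m' k *+ 'C(p.+1, k))); last first.
  move=> k _; rewrite IH//; exact: ltn_trans (ltn_ord k) _.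
have -> : 2^-1 + 2^-1 = 1 :> R by field.
rewrite !mul1r => /addrI /eqP; rewrite -subr_eq0 -mulrnBl mulrn_eq0 subr_eq0.
by rewrite eqn0Ngt bin_gt0 leqnSn => /eqP.
Qed.

End midpoint_sums.

(** * Mean value inequality and a Taylor bound *)

Section taylor_bound.
Context {R : realType}.
Implicit Types (phi : nat -> R -> R) (f df : R -> R).

Lemma is_derive_monomial (c : R) (n : nat) (t : R) :
  is_derive t (1 : R) (fun t => c * t ^+ n) (c * (n%:R * t ^+ n.-1)).
Proof.
have := @is_deriveZ _ _ _ ((@id R) ^+ n) c t 1 _ (@is_deriveX _ _ id n t 1 1 _).
rewrite /= => /(_ (is_derive_id _ _)) H.
have -> : (fun t => c * t ^+ n) = c \*: (@id R) ^+ n.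
  by apply/funext => u; rewrite /= exprfctE.
by apply: is_derive_eq H _; congr (_ * _); rewrite /= -[RHS]mulr1.
Qed.

Lemma is_derive_comp_affine f df (c d x : R) :
  is_derive (c * x + d) (1 : R) f (df (c * x + d)) ->
  is_derive x (1 : R) (fun t => f (c * t + d)) (c * df (c * x + d)).
Proof.
move=> H.
have K : is_derive x (1 : R) (fun t => c * t + d) c.
  have K := @is_deriveD R R R (fun t => c * t ^+ 1) (cst d) x 1 _ _
    (is_derive_monomial c 1 x) (is_derive_cst _ _ _).
  by apply: is_derive_eq K _; rewrite mul1r expr0 mulr1 addr0.
by rewrite mulrC; exact: (@is_derive1_comp _ f (fun t => c * t + d)).
Qed.

Lemma mean_value_bound f df (M t : R) :
  (forall x, is_derive x (1 : R) f (df x)) ->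
  (forall x, `|x| <= `|t| -> `|df x| <= M) -> `|f t - f 0| <= M * `|t|.
Proof.
move=> fdf dfM.
have cf : continuous f.
  by move=> x; apply/differentiable_continuous/derivable1_diffP; case: (fdf x).
have [t0|t0] := leP 0 t.
  have [c ct ->] := MVT_segment t0 (fun x _ => fdf x) (continuous_subspaceT cf).
  rewrite normrM subr0 ler_wpM2r// dfM//.
  by move: ct; rewrite in_itv/= => /andP[c0 ct]; rewrite !ger0_norm.
have [c ct e] := MVT_segment (ltW t0) (fun x _ => fdf x) (continuous_subspaceT cf).
rewrite distrC e sub0r normrM normrN ler_wpM2r// dfM//.
move: ct; rewrite in_itv/= => /andP[tc c0].
by rewrite !ler0_norm// ?lerN2//; exact: ltW.
Qed.

(** The derivative in t of the remainder of order N + 1 is the remainder of order N for the family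
    shifted by one, and the mean value inequality adds a factor |t|. The usual 1 / N! is given up:
    only smallness matters here. *)
Lemma taylor_bound phi N (x0 T e : R) :
  (forall i x, (i < N)%N -> is_derive x (1 : R) (phi i) (phi i.+1 x)) ->
  (forall x, `|x - x0| <= T -> `|phi N x| <= e) ->
  forall t, `|t| <= T ->
  `|phi 0 (x0 + t) - \sum_(i < N) phi i x0 / i`!%:R * t ^+ i| <= e * `|t| ^+ N.
Proof.
elim: N phi => [|N IH] phi dphi bphi t tT.
  by rewrite big_ord0 subr0 expr0 mulr1 bphi// addrC addKr.
pose f t := phi 0 (x0 + t) - \sum_(i < N.+1) phi i x0 / i`!%:R * t ^+ i.
pose df t := phi 1 (x0 + t) - \sum_(i < N) phi i.+1 x0 / i`!%:R * t ^+ i.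
have fdf x : is_derive x (1 : R) f (df x).
  rewrite /f /df; apply: is_deriveB.
    have := @is_derive_comp_affine (phi 0) (phi 1) 1 x0 x (dphi _ _ _).
    rewrite !mul1r addrC => /(_ isT).
    by under [in X in X -> _]eq_fun => u do rewrite mul1r addrC.
  have := @is_derive_sum R R R N.+1 (fun (i : 'I_N.+1) (t : R) => phi i x0 / i`!%:R * t ^+ i) x 1 _
    (fun i => is_derive_monomial _ i x).
  have -> : (\sum_(i < N.+1) (fun t => phi i x0 / i`!%:R * t ^+ i)) =
      fun t => \sum_(i < N.+1) phi i x0 / i`!%:R * t ^+ i.
    by apply/funext => u; rewrite fct_sumE.
  rewrite big_ord_recl/= mul0r mulr0 add0r => H.
  apply: is_derive_eq H _; apply: eq_bigr => i _.
  rewrite /bump/= add1n factS natrM; field.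
  by rewrite pnatr_eq0 -lt0n fact_gt0 addrC natr1 pnatr_eq0.
have f0 : f 0 = 0.
  rewrite /f addr0 big_ord_recl/= expr0 fact0 divr1 mulr1 big1 ?addr0 ?subrr//.
  by move=> i _; rewrite expr0n mulr0.
rewrite -/(f t) -[f t]subr0 -f0 exprS mulrCA mulrA [X in X * _]mulrC.
rewrite -mulrA [`|t| * _]mulrC mulrA.
apply: (mean_value_bound fdf) => x xt.
apply: (@le_trans _ _ (e * `|x| ^+ N)).
  apply: (IH (fun i => phi i.+1)) => [i y iN|y yT|]; [exact: dphi|exact: bphi|].
  exact: le_trans tT.
have e0 : 0 <= e.
  apply: le_trans (bphi x0 _); first exact: normr_ge0.
  by rewrite subrr normr0 (le_trans _ tT).
by rewrite ler_wpM2l// lerXn2r// nnegrE.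
Qed.

End taylor_bound.

(** * Decay of the difference between [G m F n] and [G m0 F n] *)

Section G_difference.
Context {R : realType}.

(** The constant is the total absolute weight of the nodes, j of them for each j. All nodes lie
    within (m - 1) / 2 of n - 1/2, so the radius m is generous. *)
Lemma G_taylor_bound (m N : nat) (F : R -> R) (e : R) (psi : nat -> R) (n : nat) :
  (forall t, `|t| <= m%:R ->
    `|F (n%:R - 1 / 2 + t) - \sum_(k < N) psi k * t ^+ k| <= e) ->
  `|G m F n - \sum_(k < N) psi k * central_moment m k| <=
    (\sum_(1 <= j < m.+1) `|gamma_coef R m j| * j%:R) * e.
Proof.
move=> Fe; pose x (j i : nat) : R := j%:R / 2 - 1 / 2 - i%:R.
have -> : G m F n - \sum_(k < N) psi k * central_moment m k =
    \sum_(1 <= j < m.+1) gamma_coef R m j * \sum_(0 <= i < j)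
      (F (n%:R - 1 / 2 + x j i) - \sum_(k < N) psi k * x j i ^+ k).
  under [in RHS]eq_bigr => j _ do rewrite sumrB mulrBr.
  rewrite sumrB; congr (_ - _).
    apply: eq_bigr => j _; congr (_ * _); apply: eq_bigr => i _; congr F.
    by rewrite /x; field.
  under eq_bigr => k _ do rewrite mulr_sumr.
  rewrite exchange_big/=; apply: eq_bigr => j _.
  under eq_bigr => k _ do rewrite mulrCA mulr_sumr.
  by rewrite -mulr_sumr exchange_big.
rewrite mulr_suml (le_trans (ler_norm_sum _ _ _))// big_nat [leRHS]big_nat.
apply: ler_sum => j /andP[_ jm]; rewrite normrM -mulrA ler_wpM2l//.
rewrite (le_trans (ler_norm_sum _ _ _))//.
apply: (@le_trans _ _ (\sum_(0 <= i < j) e)); last first.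
  by rewrite sumr_const_nat subn0 mulr_natl.
rewrite big_nat [leRHS]big_nat; apply: ler_sum => i /andP[_ ij].
apply: Fe; rewrite /x ler_norml.
have : (i.+1%:R <= j%:R :> R) by rewrite ler_nat.
have : (j%:R <= m%:R :> R) by rewrite ler_nat.
have : (0 <= i%:R :> R) by [].
by rewrite -natr1; lra.
Qed.

Lemma G_sub_cvg0 (m0 m : nat) (phi : nat -> R -> R) : (m0 <= m)%N ->
  (forall i x, (i < 2 * m0)%N -> is_derive x (1 : R) (phi i) (phi i.+1 x)) ->
  phi (2 * m0)%N x @[x --> +oo] --> (0 : R) ->
  (G m (phi 0) n - G m0 (phi 0) n) @[n --> \oo] --> (0 : R).
Proof.
move=> m0m dphi phi0.
pose K : R := \sum_(1 <= j < m.+1) `|gamma_coef R m j| * j%:R +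
  \sum_(1 <= j < m0.+1) `|gamma_coef R m0 j| * j%:R.
have K0 : 0 <= K.
  by rewrite addr_ge0//; apply: sumr_ge0 => j _; rewrite mulr_ge0.
(* The two added ones make [D] positive and give K * m ^ (2 m0) <= D, which absorbs all constants in
   the final estimate. *)
pose D : R := (K + 1) * (m%:R ^+ (2 * m0) + 1).
have D0 : 0 < D by rewrite mulr_gt0// ltr_wpDl// exprn_ge0.
apply/cvgrPdist_le => e e0.
have eD0 : 0 < e / D by rewrite divr_gt0.
move/cvgrPdist_le : phi0 => /(_ _ eD0)[A [_ HA]].
(* This makes n - 1/2 - m exceed A, so that the smallness of [phi (2 * m0)] holds on the whole
   neighbourhood used by Taylor's bound. *)
exists (Num.truncn (`|A| + m%:R + 1)).+1 => // n /= nA.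
have {}nA : `|A| + m%:R + 1 < n%:R.
  by rewrite (lt_le_trans (truncnS_gt _))// ler_nat.
rewrite sub0r normrN.
have Fe t : `|t| <= m%:R -> `|phi 0 (n%:R - 1 / 2 + t) -
    \sum_(k < 2 * m0) phi k (n%:R - 1 / 2) / k`!%:R * t ^+ k| <=
    e / D * m%:R ^+ (2 * m0).
  move=> tm; apply: (@le_trans _ _ (e / D * `|t| ^+ (2 * m0))); last first.
    by apply: ler_wpM2l; [exact: ltW|rewrite lerXn2r ?nnegrE].
  apply: (@taylor_bound _ phi _ _ m%:R) => // x xm.
  rewrite -normrN -sub0r; apply: HA.
  have := ler_norm A; move: xm; rewrite ler_norml; lra.
pose P := \sum_(k < 2 * m0) phi k (n%:R - 1 / 2) / k`!%:R * central_moment m k.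
have PE : P = \sum_(k < 2 * m0) phi k (n%:R - 1 / 2) / k`!%:R * central_moment m0 k.
  apply: eq_bigr => k _; congr (_ * _); apply: central_moment_indep => //.
  by rewrite (leq_trans (ltn_ord k))// leq_mul2l m0m orbT.
have -> : G m (phi 0) n - G m0 (phi 0) n =
  (G m (phi 0) n - P) - (G m0 (phi 0) n - P) by ring.
apply: (le_trans (ler_normB _ _)).
pose psi k := phi k (n%:R - 1 / 2) / k`!%:R.
have H1 := @G_taylor_bound m _ (phi 0) _ psi n Fe.
have H2 := @G_taylor_bound m0 _ (phi 0) _ psi n
  (fun t (h : `|t| <= m0%:R) => Fe t (le_trans h _)).
rewrite -[X in `|_ - X|]PE in H2.
apply: (le_trans (lerD H1 (H2 _))); first by rewrite ler_nat.
rewrite -mulrDl -/K.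
have -> : K * (e / D * m%:R ^+ (2 * m0)) = e * (K * m%:R ^+ (2 * m0) / D) by ring.
rewrite -[leRHS]mulr1; apply: ler_wpM2l; first exact: ltW.
rewrite ler_pdivrMr// mul1r /D ler_pM ?exprn_ge0//; first by rewrite lerDl.
by rewrite lerDl.
Qed.

End G_difference.

(** * Affine change of variable for Lebesgue measure *)

Section affine_change_of_variable.
Context {R : realType}.
Local Notation mu := (@lebesgue_measure R).

Implicit Types (c d : R).

(** Both sides are measures in A, so comparing them on the intervals []a, b]] is enough. For c < 0
    the preimage contains its left endpoint instead of its right one, which does not affect the
    length. *)
Lemma lebesgue_measure_affine c d (A : set R) : c != 0 -> measurable A ->
  mu A = (`|c|%:E * mu ((fun x => c * x + d)%R @^-1` A))%E.
Proof.
move=> c0 mA.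
have mf : measurable_fun [set: R] (fun x => c * x + d : measurableTypeR R).
  exact: measurable_funD.
pose f x : measurableTypeR R := c * x + d.
have c00 : 0 <= `|c| by [].
pose nu := mscale (NngNum c00) (pushforward mu f) : {measure set (measurableTypeR R) -> \bar R}.
rewrite (@lebesgue_measure_unique R (nu mf))//.
move=> _ [[a b]/= _ <-].
rewrite /nu/= /mscale/= /pushforward/=.
have [cp|cn] := ltP 0 c.
- have -> : (fun x => c * x + d) @^-1` `]a, b] = `](a - d) / c, (b - d) / c]%classic.
    apply/seteqP; split => x /=; rewrite !in_itv/=.
      by rewrite ltr_pdivrMr// ler_pdivlMr// ltrBlDr lerBrDr mulrC.
    by rewrite ltr_pdivrMr// ler_pdivlMr// ltrBlDr lerBrDr mulrC.
  rewrite !lebesgue_measure_itv/= !lte_fin ltr_pM2r ?invr_gt0// ltrD2r.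
  case: ifPn => _; last by rewrite mule0.
  rewrite -!EFinB -EFinM gtr0_norm//; congr _%:E; by field.
- have {}cn : c < 0 by rewrite lt_neqAle c0.
  have -> : (fun x => c * x + d) @^-1` `]a, b] = `[(b - d) / c, (a - d) / c[%classic.
    apply/seteqP; split => x /=; rewrite !in_itv/= andbC.
      by rewrite ltr_ndivlMr// ler_ndivrMr// ltrBlDr lerBrDr mulrC.
    by rewrite ltr_ndivlMr// ler_ndivrMr// ltrBlDr lerBrDr mulrC.
  rewrite !lebesgue_measure_itv/= !lte_fin ltr_nM2r ?invr_lt0// ltrD2r.
  case: ifPn => _; last by rewrite mule0.
  rewrite -!EFinB -EFinM ltr0_norm//; congr _%:E; by field.
Qed.

Lemma ge0_integral_affine c d (f : R -> \bar R) : c != 0 ->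
  measurable_fun setT f -> (forall x, 0 <= f x)%E ->
  (\int[mu]_x f x = `|c|%:E * \int[mu]_x f (c * x + d)%R)%E.
Proof.
move=> c0 mf f0.
have ma : measurable_fun [set: R] (fun x => c * x + d : measurableTypeR R).
  exact: measurable_funD.
have c00 : 0 <= `|c| by [].
pose g x : measurableTypeR R := c * x + d.
pose nu := mscale (NngNum c00) (pushforward mu g) : {measure set (measurableTypeR R) -> \bar R}.
rewrite (@eq_measure_integral _ _ _ setT (nu ma)); last first.
  by move=> A mA _; rewrite /nu/= /mscale/= /pushforward; exact: lebesgue_measure_affine.
by rewrite /nu ge0_integral_mscale//= ge0_integral_pushforward//= preimage_setT.
Qed.

Lemma integrable_affine c d (f : R -> R) : c != 0 ->
  mu.-integrable setT (EFin \o f) ->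
  mu.-integrable setT (EFin \o (fun x => f (c * x + d))).
Proof.
move=> c0 /integrableP[mf foo].
have ma : measurable_fun [set: R] (fun x => c * x + d : R) by exact: measurable_funD.
apply/integrableP; split.
  by apply: (measurableT_comp mf ma).
move: foo; rewrite (@ge0_integral_affine c d)//; last exact: measurableT_comp.
rewrite /= => h.
have : (\int[mu]_x `|(f (c * x + d))%:E| \is a fin_num)%E.
  rewrite ge0_fin_numE; last exact: integral_ge0.
  move: h; case: (\int[mu]_x _)%E => [r||]; rewrite ?ltry//.
  by rewrite mulry gtr0_sg ?normr_gt0// mul1e.
by rewrite ge0_fin_numE//; exact: integral_ge0.
Qed.

Lemma Rintegral_affine c d (f : R -> R) : c != 0 ->
  mu.-integrable setT (EFin \o f) ->
  \int[mu]_x f (c * x + d) = `|c|^-1 * \int[mu]_x f x.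
Proof.
move=> c0 fi; have mf := measurable_int _ fi.
pose g x := f (c * x + d).
have gi : mu.-integrable setT (EFin \o g) := integrable_affine d c0 fi.
apply: (@mulfI _ `|c|); first by rewrite normr_eq0.
rewrite mulrA divff ?normr_eq0// mul1r.
apply: EFin_inj; rewrite EFinM /Rintegral !fineK ?integrable_fin_num//=.
rewrite [RHS]integralE.
rewrite (@ge0_integral_affine c d (EFin \o f)^\+%E)//; last exact: measurable_funepos.
rewrite (@ge0_integral_affine c d (EFin \o f)^\-%E)//; last exact: measurable_funeneg.
have -> : (\int[mu]_x (EFin \o f)^\+%E (c * x + d)%R =
    \int[mu]_x (EFin \o g)^\+%E x)%E by apply: eq_integral => x _; rewrite !funeposE.
have -> : (\int[mu]_x (EFin \o f)^\-%E (c * x + d)%R =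
    \int[mu]_x (EFin \o g)^\-%E x)%E by apply: eq_integral => x _; rewrite !funenegE.
have -> : (\int[mu]_x (f (c * x + d))%:E = \int[mu]_x (EFin \o g) x)%E by [].
have gp := @integrable_pos_fin_num _ _ _ mu setT measurableT _ gi.
by rewrite [X in (_ * X)%E]integralE; apply: muleBr => //; exact: fin_num_adde_defr.
Qed.

End affine_change_of_variable.

(** * Calculus of Radon-Nikodym derivatives *)

Section Radon_Nikodym_derivatives.
Context {R : realType}.
Local Notation mu := (@lebesgue_measure R).
Local Notation RN := (@is_Radon_Nikodym_derivative R).
Implicit Types (f g h : R -> R).

Lemma RN_comp_affine (c d : R) h g : RN h g ->
  RN (fun x => h (c * x + d)) (fun x => c * g (c * x + d)).
Proof.
move=> hg a b ab; have [->|c0] := eqVneq c 0.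
  rewrite !mul0r subrr; split.
    apply: eq_integrable (integrable0 _ _) => // x _.
    by rewrite /= mul0r.
  rewrite (@eq_Rintegral _ _ _ _ _ (cst 0)) => [|x _]; last by rewrite mul0r.
  by rewrite Rintegral_cst//= mul0r.
(* For c < 0 the map exchanges the endpoints of the interval; the sign is compensated at the end by
   c / |c| = -1. *)
pose u := Num.min (c * a + d) (c * b + d); pose v := Num.max (c * a + d) (c * b + d).
have uv : u <= v by rewrite /u /v ge_min !le_max !lexx.
have Exab x : (u <= c * x + d <= v) = (a <= x <= b).
  have [cp|cn] := ltP 0 c.
    have le : c * a + d <= c * b + d by rewrite lerD2r ler_pM2l.
    rewrite /u /v (min_l le) (max_r le).
    by rewrite !lerD2r !ler_pM2l.
  have {}cn : c < 0 by rewrite lt_neqAle c0.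
  have le : c * b + d <= c * a + d by rewrite lerD2r ler_nM2l.
  rewrite /u /v (min_r le) (max_l le).
  by rewrite !lerD2r !ler_nM2l// andbC.
have [gi ge] := hg _ _ uv.
(* The change of variable is on the whole line, where g need not be integrable; hence the
   cut-off. *)
pose q := g \_ `[u, v].
have qi : mu.-integrable setT (EFin \o q).
  by move/(integrable_mkcond _ _) : gi => /(_ (measurable_itv _)); rewrite restrict_EFin.
have qE : (fun x => q (c * x + d)) = (fun x => g (c * x + d)) \_ `[a, b].
  apply/funext => x; rewrite /q !patchE; congr (if _ then _ else _).
  by apply/idP/idP; rewrite !inE/= !in_itv/= Exab.
have gai : mu.-integrable `[a, b] (EFin \o (fun x => g (c * x + d))).
  apply/integrable_mkcond => //.
  by rewrite restrict_EFin -qE; exact: integrable_affine.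
split.
  have := @integrableZl _ _ _ mu _ (measurable_itv `[a, b]) c _ gai.
  by apply: eq_integrable.
rewrite RintegralZl// Rintegral_mkcond -qE Rintegral_affine// -Rintegral_mkcond.
rewrite ge; have [cp|cn] := ltP 0 c.
  have le : c * a + d <= c * b + d by rewrite lerD2r ler_pM2l.
    rewrite /u /v (min_l le) (max_r le).
  by rewrite gtr0_norm// mulrA divff// mul1r.
have {}cn : c < 0 by rewrite lt_neqAle c0.
have le : c * b + d <= c * a + d by rewrite lerD2r ler_nM2l.
  rewrite /u /v (min_r le) (max_l le).
by rewrite ltr0_norm// invrN mulrA mulrN divff// mulN1r opprB.
Qed.

Lemma RN_sum (n : nat) (h g : nat -> R -> R) : (forall k, RN (h k) (g k)) ->
  RN (fun x => \sum_(0 <= k < n) h k x) (fun x => \sum_(0 <= k < n) g k x).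
Proof.
move=> hg a b ab; elim: n => [|n [IHi IH]].
  split.
    apply: eq_integrable (integrable0 _ _) => // x _.
    by rewrite /= big_geq.
  rewrite (@eq_Rintegral _ _ _ _ _ (cst 0)) => [|x _]; last by rewrite big_geq.
  by rewrite Rintegral_cst//= mul0r !big_geq// subrr.
have [gi ge] := hg n _ _ ab.
split.
  have := @integrableD _ _ _ mu _ (measurable_itv `[a, b]) _ _ IHi gi.
  by apply: eq_integrable => // x _; rewrite /= big_nat_recr.
under eq_Rintegral => x _ do rewrite big_nat_recr//=.
by rewrite RintegralD// IH ge !big_nat_recr//=; ring.
Qed.

Lemma RN_is_derive h g : (forall x, is_derive x (1 : R) h (g x)) ->
  continuous g -> RN h g.
Proof.
move=> hg cg a b; rewrite le_eqVlt => /predU1P[<-|ab].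
  split; last by rewrite set_itv1 Rintegral_set1 subrr.
  apply: continuous_compact_integrable; first exact: segment_compact.
  exact: continuous_subspaceT.
split.
  apply: continuous_compact_integrable; first exact: segment_compact.
  exact: continuous_subspaceT.
have ch : continuous h.
  by move=> x; apply/differentiable_continuous/derivable1_diffP; case: (hg x).
rewrite /Rintegral (continuous_FTC2 ab _ (F := h))//.
- exact: continuous_subspaceT.
- split => [x _||]; first by case: (hg x).
    exact/cvg_at_right_filter/ch.
  exact/cvg_at_left_filter/ch.
- by move=> x _; rewrite derive1E; case: (hg x).
Qed.

End Radon_Nikodym_derivatives.

(** * Fubini's theorem for real-valued integrals *)

Section real_Fubini.
Context {R : realType}.
Local Notation mu := (@lebesgue_measure R).
Local Notation mu2 := (mu \x mu)%E.
Implicit Types (k : R * R -> R) (q w : R -> R).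

(** The inner real integral is [fine] of the extended one. The two agree wherever the latter is
    finite, hence for almost every s, and the outer integral sees no more than that. *)
Lemma Rintegral12_prod k : mu2.-integrable setT (EFin \o k) ->
  \int[mu]_s (\int[mu]_t k (s, t)) = \int[mu2]_p k p.
Proof.
move=> ki; rewrite {1 3}/Rintegral; congr fine.
have Fi := integrable_fubini_F ki; have mF := measurable_int _ Fi.
rewrite -[RHS](integral12_prod_meas1 ki); apply: ae_eq_integral => //.
  apply/measurable_EFinP.
  exact: (@measurableT_comp _ _ _ _ _ _ (@fine R) _ _ _ mF).
have := integrable_ae measurableT Fi.
by apply: filterS => s /(_ I) sfin _; rewrite /Rintegral fineK.
Qed.

Lemma Rintegral21_prod k : mu2.-integrable setT (EFin \o k) ->
  \int[mu]_t (\int[mu]_s k (s, t)) = \int[mu2]_p k p.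
Proof.
move=> ki; rewrite {1 3}/Rintegral; congr fine.
have mG := measurable_fubini_G ki.
rewrite -[RHS](integral21_prod_meas1 ki); apply: ae_eq_integral => //.
  apply/measurable_EFinP.
  exact: (@measurableT_comp _ _ _ _ _ _ (@fine R) _ _ _ mG).
have := ae_integrable2 ki.
apply: filterS => t ti _; rewrite /Rintegral fineK//.
by have := @integrable_fin_num _ _ _ mu setT measurableT _ ti.
Qed.

Lemma integrable_prod q w : mu.-integrable setT (EFin \o q) ->
  mu.-integrable setT (EFin \o w) ->
  mu2.-integrable setT (EFin \o (fun p => q p.1 * w p.2)).
Proof.
move=> qi wi.
have /measurable_EFinP mq := measurable_int _ qi.
have /measurable_EFinP mw := measurable_int _ wi.
have m : measurable_fun [set: R * R] (fun p => q p.1 * w p.2).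
  by apply: measurable_funM; [exact: measurableT_comp mq measurable_fst|
    exact: measurableT_comp mw measurable_snd].
apply/integrable12ltyP; first exact/measurable_EFinP.
have /integrableP[_ qoo] := qi; have /integrableP[_ woo] := wi.
have wfin : (\int[mu]_t `|(w t)%:E| \is a fin_num)%E.
  by rewrite ge0_fin_numE; [exact: woo|exact: integral_ge0].
have E s : (\int[mu]_t `|(EFin \o (fun p => q p.1 * w p.2)%R) (s, t)| =
    (\int[mu]_t `|(w t)%:E|) * `|(q s)%:E|)%E.
  rewrite muleC -ge0_integralZl//.
    by apply: eq_integral => t _; rewrite /= normrM EFinM.
  by apply: measurableT_comp => //; exact: measurable_int wi.
under eq_integral => s _ do rewrite E.
rewrite ge0_integralZl//; last 2 first.
- by apply: measurableT_comp => //; exact: measurable_int qi.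
- exact: integral_ge0.
by apply: lte_mul_pinfty => //; exact: integral_ge0.
Qed.

End real_Fubini.

(** * Integration by parts and Taylor's formula on the unit interval *)

Section by_parts.
Context {R : realType}.
Local Notation mu := (@lebesgue_measure R).
Local Notation RN := (@is_Radon_Nikodym_derivative R).
Implicit Types (g h : R -> R).

Lemma is_derive_continuous (f df : R -> R) :
  (forall x, is_derive x (1 : R) f (df x)) -> continuous f.
Proof.
by move=> fdf x; apply/differentiable_continuous/derivable1_diffP; case: (fdf x).
Qed.

Lemma is_derive_onem_pow (c : R) (n : nat) (t : R) :
  is_derive t (1 : R) (fun t => c * (1 - t) ^+ n) (- (c * (n%:R * (1 - t) ^+ n.-1))).
Proof.
have := @is_derive_comp_affine _ (fun x => c * x ^+ n)
  (fun x => c * (n%:R * x ^+ n.-1)) (-1) 1 t (is_derive_monomial _ _ _).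
have -> : (fun t => c * (-1 * t + 1) ^+ n) = (fun t : R => c * (1 - t) ^+ n).
  by apply/funext => x; rewrite mulN1r addrC.
by move=> H; apply: is_derive_eq H _; rewrite !mulN1r [- t + 1]addrC.
Qed.

Lemma continuous_onem_pow (c : R) (n : nat) :
  continuous (fun t : R => c * (1 - t) ^+ n).
Proof. exact: is_derive_continuous (is_derive_onem_pow c n). Qed.

Lemma continuous_onem_exp (n : nat) : continuous (fun t : R => (1 - t) ^+ n).
Proof.
rewrite (_ : (fun t : R => (1 - t) ^+ n) = (fun t => 1 * (1 - t) ^+ n)).
  exact: continuous_onem_pow.
by apply/funext => x; rewrite mul1r.
Qed.

Lemma RN_onem_pow (K : nat) :
  RN (fun t => - (1 - t) ^+ K.+1) (fun t => K.+1%:R * (1 - t) ^+ K).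
Proof.
apply: RN_is_derive; last exact: continuous_onem_pow.
move=> t; have H := is_derive_onem_pow (-1) K.+1 t.
have -> : (fun t : R => - (1 - t) ^+ K.+1) = (fun t => -1 * (1 - t) ^+ K.+1).
  by apply/funext => x; rewrite mulN1r.
by apply: is_derive_eq H _; rewrite mulN1r opprK.
Qed.

(** Integrate g(s) p(t), with p(t) = (K + 1) (1 - t) ^ K, over the triangle 0 <= s <= t <= 1 in both
    orders. Integrating in t first gives g(s) (1 - s) ^ (K + 1); in s first it gives p(t) (h(t) -
    h(0)). Only the integrals of g enter, never a derivative of h at a point. *)
Lemma RN_by_parts (K : nat) h g : continuous h -> RN h g ->
  \int[mu]_(s in `[0, 1]) ((1 - s) ^+ K.+1 * g s) =
  - h 0 + K.+1%:R * \int[mu]_(t in `[0, 1]) ((1 - t) ^+ K * h t).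
Proof.
move=> ch hg.
pose p t : R := K.+1%:R * (1 - t) ^+ K.
have cp : continuous p.
  exact: continuous_onem_pow.
have ci (f : R -> R) : continuous f -> mu.-integrable `[0, 1] (EFin \o f).
  move=> cf; apply: continuous_compact_integrable; first exact: segment_compact.
  exact: continuous_subspaceT.
have [gi _] := hg 0 1 ler01.
pose q := g \_ `[0, 1]; pose w := p \_ `[0, 1].
have qi : mu.-integrable setT (EFin \o q).
  by move/(integrable_mkcond _ _) : gi => /(_ (measurable_itv _)); rewrite restrict_EFin.
have wi : mu.-integrable setT (EFin \o w).
  have /(integrable_mkcond _ _) := ci _ cp => /(_ (measurable_itv _)).
  by rewrite restrict_EFin.
pose k (x : R * R) := if x.1 <= x.2 then q x.1 * w x.2 else 0.
have ki : (mu \x mu)%E.-integrable setT (EFin \o k).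
  have qwi := integrable_prod qi wi.
  apply: le_integrable (qwi) => //.
    apply/measurable_EFinP/measurable_fun_ifT => //.
      exact: measurable_fun_ler.
    by have /measurable_EFinP := measurable_int _ qwi.
  move=> x _ /=; rewrite lee_fin /k; case: ifP => // _.
  by rewrite normr0.
have := Rintegral12_prod ki; rewrite -(Rintegral21_prod ki).
have -> : (fun s => \int[mu]_t k (s, t)) = (fun s => (1 - s) ^+ K.+1 * g s) \_ `[0, 1].
  apply/funext => s; rewrite patchE; case: ifPn => s01; last first.
    rewrite (@eq_Rintegral _ _ _ _ _ (cst 0)) ?Rintegral_cst ?mul0r// => t _.
    by rewrite /k/= /q patchE (negbTE s01) mul0r if_same.
  have {}s01 : 0 <= s <= 1 by move: s01; rewrite inE/= in_itv.
  have [s0 s1] := andP s01.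
  have [pi pE] := RN_onem_pow K s1.
  rewrite (_ : (fun t => k (s, t)) = (fun t => g s * p t) \_ `[s, 1]).
    rewrite -Rintegral_mkcond RintegralZl// pE subrr expr0n/= oppr0 sub0r opprK.
    by rewrite mulrC.
  apply/funext => t; rewrite /k/= /q /w !patchE !mem_setE !in_itv/= s01.
  case: leP => //= st; rewrite (le_trans s0 st)/=.
  by case: ifP => //; rewrite mulr0.
rewrite -Rintegral_mkcond => ->.
have -> : (fun t => \int[mu]_s k (s, t)) = (fun t => p t * h t - h 0 * p t) \_ `[0, 1].
  apply/funext => t; rewrite patchE; case: ifPn => t01; last first.
    rewrite (@eq_Rintegral _ _ _ _ _ (cst 0)) ?Rintegral_cst ?mul0r// => s _.
    by rewrite /k/= /w patchE (negbTE t01) mulr0 if_same.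
  have {}t01 : 0 <= t <= 1 by move: t01; rewrite inE/= in_itv.
  have [t0 t1] := andP t01.
  have [pi pE] := hg _ _ t0.
  rewrite (_ : (fun s => k (s, t)) = (fun s => p t * g s) \_ `[0, t]).
    by rewrite -Rintegral_mkcond RintegralZl// pE mulrBr [h 0 * _]mulrC.
  apply/funext => s; rewrite /k/= /q /w !patchE !mem_setE !in_itv/= t01.
  case: leP => //= st; last by rewrite andbF.
  by rewrite (le_trans st t1) andbT; case: ifP => // _; rewrite ?mul0r// mulrC.
have phi : continuous (fun t => p t * h t).
  by move=> t; apply: cvgM; [exact: cp|exact: ch].
rewrite -Rintegral_mkcond RintegralB//; last 2 first.
- exact: ci.
- by apply: ci => t; apply: cvgM; [exact: cvg_cst|exact: cp].
rewrite RintegralZl//; last exact: ci.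
have [_ ->] := RN_onem_pow K ler01.
rewrite subr0 expr1n subrr expr0n/= oppr0 sub0r opprK mulr1 addrC; congr (_ + _).
under eq_Rintegral => t _ do rewrite /p -mulrA.
rewrite RintegralZl//; apply: (ci (fun t => (1 - t) ^+ K * h t)) => t.
by apply: cvgM; [exact: continuous_onem_exp|exact: ch].
Qed.

(** Repeated integration by parts. Only the top order involves a mere Radon-Nikodym derivative; one
    order below, [phi N.+1] is a continuous classical derivative and qualifies through
    [RN_is_derive]. *)
Lemma RN_taylor1 (phi : nat -> R -> R) (N : nat) g :
  (forall i x, (i < N)%N -> is_derive x (1 : R) (phi i) (phi i.+1 x)) ->
  continuous (phi N) -> RN (phi N) g ->
  \int[mu]_(s in `[0, 1]) ((1 - s) ^+ N * g s) =
  N`!%:R * (phi 0 1 - \sum_(i < N.+1) phi i 0 / i`!%:R).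
Proof.
elim: N g => [|N IH] g dphi cphi phig.
  rewrite big_ord1 !fact0 divr1 mul1r.
  under eq_Rintegral => s _ do rewrite expr0 mul1r.
  by have [_ ->] := phig 0 1 ler01.
rewrite (RN_by_parts N cphi phig).
have dN x : is_derive x (1 : R) (phi N) (phi N.+1 x) by exact: dphi.
have -> := IH (phi N.+1) (fun i x iN => dphi i x (ltnW iN))
  (is_derive_continuous dN) (RN_is_derive dN cphi).
rewrite [in RHS]big_ord_recr/= factS natrM; field.
by rewrite pnatr_eq0 -lt0n fact_gt0 addrC natr1 pnatr_eq0.
Qed.

End by_parts.

(** * The integrand of the remainder on the plane *)

Section remainder_kernel.
Context {R : realType}.
Local Notation mu := (@lebesgue_measure R).
Local Notation mu2 := (mu \x mu)%E.
Implicit Types (q p : R -> R) (a : R) (n : nat).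

Lemma continuous_itv_integrable p (x y : R) : continuous p ->
  mu.-integrable `[x, y] (EFin \o p).
Proof.
move=> cp; apply: continuous_compact_integrable; first exact: segment_compact.
exact: continuous_subspaceT.
Qed.

Lemma integrable_mul_dilation p q (c x y : R) : continuous p ->
  mu.-integrable setT (EFin \o q) ->
  mu.-integrable `[x, y] (EFin \o (fun v => p v * q (c * v))).
Proof.
move=> cp qi; have [->|c0] := eqVneq c 0.
  have -> : (fun v => p v * q (0 * v)) = (fun v => p v * q 0).
    by apply/funext => v; rewrite mul0r.
  by apply: continuous_itv_integrable => v; apply: cvgM; [exact: cp|exact: cvg_cst].
have qci : mu.-integrable `[x, y] (EFin \o (fun v => q (c * v))).
  have -> : (fun v => q (c * v)) = (fun v => q (c * v + 0)).
    by apply/funext => v; rewrite addr0.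
  exact: integrableS (integrable_affine 0 c0 qi).
pose qc v := q (c * v).
have : mu.-integrable `[x, y] ((EFin \o p) \* (EFin \o qc))%E.
  apply: integrableMr => //; first by apply: measurable_funTS; exact: continuous_measurable_fun.
  have /compact_bounded : compact (p @` `[x, y]).
    apply: continuous_compact; last exact: segment_compact.
    exact: continuous_subspaceT.
  rewrite /bounded_set/= /bounded_near => -[M [Mr HM]].
  by exists M; split => // u Mu v vxy; apply: HM => //; exists v.
by apply: eq_integrable.
Qed.

(** The integrand of [remainder_infty] for a single j, with a = j / 2 and n = 2m - 1, extended by 0
    outside the rectangle of integration so that product measure on the whole plane applies. *)
Definition remainder_kernel a n q (sv : R * R) : R :=
  (((fun s => (1 - s) ^+ n) : R -> R) \_ `[0, 1]) sv.1 *
  (((fun v => v ^+ n.+1) : R -> R) \_ `[-1, 1]) sv.2 * q (a * sv.1 * sv.2).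

Lemma measurable_remainder_kernel a n q : measurable_fun setT q ->
  measurable_fun setT (remainder_kernel a n q).
Proof.
move=> mq; apply: measurable_funM.
  apply: measurable_funM.
    apply: measurableT_comp measurable_fst; apply: (measurable_restrictT _ _).1 => //.
    by apply: measurable_funTS; apply: continuous_measurable_fun; exact: continuous_onem_exp.
  by apply: measurableT_comp measurable_snd; apply: (measurable_restrictT _ _).1.
apply: measurableT_comp => //; apply: measurable_funM; last exact: measurable_snd.
by apply: measurable_funM => //; exact: measurable_fst.
Qed.

(** On the rectangle all powers are at most 1 in absolute value. One factor |v| is nevertheless
    kept, to be spent in the proof of integrability. *)
Lemma remainder_kernel_le a n q (sv : R * R) :
  `|remainder_kernel a n q sv| <=
  (\1_(`[0, 1]%classic) sv.1 * \1_(`[-1, 1]%classic) sv.2 : R) *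
  (`|sv.2| * `|q (a * sv.1 * sv.2)|).
Proof.
rewrite /remainder_kernel !normrM !patchE !indicE mulrA.
(* [point], the value of a restricted function outside the interval, is 0 in R. *)
case: ifPn => s01; last by rewrite (_ : point = 0)// normr0 !mul0r.
case: ifPn => v01; last by rewrite (_ : point = 0)// normr0 !(mulr0, mul0r).
apply: ler_wpM2r => //; rewrite !mul1r exprS normrM !normrX mulrCA.
move: s01 v01; rewrite !inE/= !in_itv/= => s01 v01.
rewrite -[leRHS]mulr1 ler_wpM2l// mulr_ile1 ?exprn_ge0// exprn_ile1//.
  by rewrite ger0_norm; lra.
by rewrite ler_norml.
Qed.

(* Tonelli with s innermost: the factor v ^+ n.+1 absorbs the 1 / `|a * v| that
   the dilation by a * v produces. *)
Lemma integrable_remainder_kernel a n q : a != 0 ->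
  mu.-integrable setT (EFin \o q) ->
  mu2.-integrable setT (EFin \o remainder_kernel a n q).
Proof.
move=> a0 qi; have /measurable_EFinP mq := measurable_int _ qi.
have mk := @measurable_remainder_kernel a n _ mq.
apply/integrable21ltyP; first exact/measurable_EFinP.
have /integrableP[_ qoo] := qi.
set I := (\int[mu]_x `|(EFin \o q) x|)%E in qoo.
have I0 : (0 <= I)%E by exact: integral_ge0.
apply: (@le_lt_trans _ _ (\int[mu]_v ((`|a|^-1%:E * I) * (\1_(`[-1, 1]%classic) v : R)%:E))%E).
  apply: ge0_le_integral => //.
  - by move=> v _; exact: integral_ge0.
  - apply: (@measurable_fun_fubini_tonelli_G _ _ _ _ _ mu
      (fun sv => `|(EFin \o remainder_kernel a n q) sv|%E)) => //.
    by apply: measurableT_comp => //; exact/measurable_EFinP.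
  - by apply: emeasurable_funM => //; exact/measurable_EFinP.
  move=> v _.
  (* A dilation by 0 is no change of variable, but at v = 0 the factor [v ^+ n.+1] makes the kernel
     vanish. *)
  have [->|v0] := eqVneq v 0.
    rewrite (eq_integral (cst 0%E)) ?integral0 => [|s _].
      by rewrite !mule_ge0// lee_fin.
    rewrite /= /remainder_kernel/= (_ : (_ \_ _) 0 = 0) ?(mulr0, mul0r) ?normr0//.
    by rewrite patchE expr0n/= if_same.
  have av0 : a * v != 0 by rewrite mulf_neq0.
  have mqv : measurable_fun setT (fun x => q (a * v * x + 0)).
    have /measurable_EFinP := measurable_int _ (integrable_affine 0 av0 qi).
    by [].
  apply: (@le_trans _ _ (\int[mu]_s ((\1_(`[-1, 1]%classic) v * `|v|)%:E *
      `|(q (a * v * s + 0))%:E|))%E).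
    apply: ge0_le_integral => //.
    - apply/measurable_EFinP/(measurableT_comp (@normr_measurable _ _)) => //.
      exact: (measurableT_comp mk (pair2_measurable v)).
    - by apply: emeasurable_funM => //; apply: measurableT_comp => //; exact/measurable_EFinP.
    move=> s _; rewrite /= -EFinM lee_fin.
    apply: (le_trans (remainder_kernel_le _ _ _ _)) => /=.
    rewrite addr0 [a * s * v]mulrAC mulrA ler_wpM2r// ler_wpM2r//.
    by rewrite ler_piMl// indicE; case: (_ \in _).
  rewrite ge0_integralZl//; last first.
    by apply: measurableT_comp => //; exact/measurable_EFinP.
  have IE : (I = `|a * v|%:E * \int[mu]_s `|(q (a * v * s + 0))%:E|)%E.
    rewrite /I (@ge0_integral_affine _ (a * v) 0)//.
    by apply: measurableT_comp => //; exact/measurable_EFinP.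
  rewrite IE muleA -EFinM normrM mulrA mulVf ?normr_eq0// mul1r.
  by rewrite muleC muleAC -EFinM [_ * `|v|]mulrC muleC.
rewrite ge0_integralZl//; last 2 first.
- exact/measurable_EFinP.
- by rewrite mule_ge0// lee_fin.
rewrite integral_indic// setIT; apply: lte_mul_pinfty.
- by rewrite mule_ge0// lee_fin.
- rewrite fin_numM// ge0_fin_numE//.
- by rewrite /= lebesgue_measure_itv/=; case: ifPn => _ //; rewrite -EFinB ltry.
Qed.

(** The order suited to Taylor's formula: for fixed v the integral over s is the Taylor remainder
    for the increment a v, up to powers and factorials. *)
Lemma Rintegral_remainder_kernel_vs a n q : a != 0 ->
  mu.-integrable setT (EFin \o q) ->
  \int[mu2]_sv remainder_kernel a n q sv =
  \int[mu]_(v in `[-1, 1]) (v ^+ n.+1 *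
    \int[mu]_(s in `[0, 1]) ((1 - s) ^+ n * q (a * v * s))).
Proof.
move=> a0 qi; rewrite -Rintegral21_prod; last exact: integrable_remainder_kernel.
rewrite [RHS]Rintegral_mkcond; apply: eq_Rintegral => v _; rewrite patchE.
rewrite /remainder_kernel/=; case: ifPn => v01.
  rewrite -RintegralZl//; last by apply: integrable_mul_dilation => //; exact: continuous_onem_exp.
  rewrite [RHS]Rintegral_mkcond; apply: eq_Rintegral => s _; rewrite !patchE v01.
  case: ifPn => _; last by rewrite (_ : point = 0)// !mul0r.
  by rewrite [a * s * v]mulrAC mulrCA mulrA.
rewrite (@eq_Rintegral _ _ _ _ _ (cst 0)) ?Rintegral_cst ?mul0r// => s _.
by rewrite !patchE (negbTE v01) (_ : point = 0)// mulr0 mul0r.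
Qed.

(** The kernel is linear in q, and 2 is the area of [0, 1] x [-1, 1]. This bound lets uniform
    convergence pass under the double integral without a dominating function. *)
Lemma Rintegral_remainder_kernel_close a n q1 q2 e : a != 0 ->
  mu.-integrable setT (EFin \o q1) -> mu.-integrable setT (EFin \o q2) ->
  (forall x, `|q1 x - q2 x| <= e) ->
  `|\int[mu2]_sv remainder_kernel a n q1 sv -
    \int[mu2]_sv remainder_kernel a n q2 sv| <= 2 * e.
Proof.
move=> a0 i1 i2 qe.
have e0 : 0 <= e := le_trans (normr_ge0 _) (qe 0).
have k1 := integrable_remainder_kernel n a0 i1.
have k2 := integrable_remainder_kernel n a0 i2.
have i01 : mu.-integrable setT (EFin \o (\1_(`[0, 1]%classic) : R -> R)).
  by apply: integrable_indic_itv.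
have i11 : mu.-integrable setT (EFin \o (\1_(`[-1, 1]%classic) : R -> R)).
  by apply: integrable_indic_itv.
have i2d := integrable_prod i01 i11.
rewrite -RintegralB//.
have kd : mu2.-integrable setT (EFin \o
    (fun sv => remainder_kernel a n q1 sv - remainder_kernel a n q2 sv)).
  by apply: eq_integrable (integrableB _ k1 k2).
apply: (le_trans (le_normr_Rintegral measurableT kd)).
pose b (sv : R * R) : R := e * (\1_(`[0, 1]%classic) sv.1 * \1_(`[-1, 1]%classic) sv.2).
have bi : mu2.-integrable setT (EFin \o b).
  by apply: eq_integrable (integrableZl measurableT e i2d).
apply: (@le_trans _ _ (\int[mu2]_sv b sv)).
  apply: le_Rintegral => //.
    exact: integrable_norm.
  move=> sv _; have -> : remainder_kernel a n q1 sv - remainder_kernel a n q2 sv =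
      remainder_kernel a n (fun x => q1 x - q2 x) sv by rewrite /remainder_kernel mulrBr.
  apply: (le_trans (remainder_kernel_le _ _ _ _)).
  rewrite /b [e * _]mulrC !indicE.
  case: (boolP (sv.2 \in _)) => v01; last by rewrite mulr0 !mul0r.
  apply: ler_wpM2l; first by rewrite mulr_ge0.
  rewrite -[leRHS]mul1r ler_pM//.
  by move: v01; rewrite inE/= in_itv/= ler_norml.
rewrite RintegralZl// -(Rintegral12_prod i2d)/=.
have I0 : \int[mu]_x (\1_(`[0, 1]%classic) x : R) = 1.
  rewrite /Rintegral integral_indic// setIT/= lebesgue_measure_itv/= lte_fin ltr01.
  by rewrite oppr0 addr0.
have I1 : \int[mu]_x (\1_(`[-1, 1]%classic) x : R) = 2.
  rewrite /Rintegral integral_indic// setIT/= lebesgue_measure_itv/= lte_fin.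
  by rewrite ifT /=; lra.
under eq_Rintegral => s _ do rewrite RintegralZl// I1.
by rewrite RintegralZr// I0 mul1r mulrC.
Qed.

End remainder_kernel.

(** * The Taylor remainder as a double integral *)

Section Taylor_remainder_identity.
Context {R : realType}.
Local Notation mu := (@lebesgue_measure R).
Local Notation RN := (@is_Radon_Nikodym_derivative R).

Lemma RN_scale (k : R) (h g : R -> R) : RN h g ->
  RN (fun x => k * h x) (fun x => k * g x).
Proof.
move=> hg a b ab; have [gi ge] := hg a b ab; split.
  have := @integrableZl _ _ _ mu _ (measurable_itv `[a, b]) k _ gi.
  by apply: eq_integrable.
by rewrite RintegralZl// ge mulrBr.
Qed.

Lemma RN_taylor (phi : nat -> R -> R) (n : nat) (g : R -> R) (c : R) :
  (forall i x, (i < n)%N -> is_derive x (1 : R) (phi i) (phi i.+1 x)) ->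
  continuous (phi n) -> RN (phi n) g ->
  c ^+ n.+1 * \int[mu]_(s in `[0, 1]) ((1 - s) ^+ n * g (c * s)) =
  n`!%:R * (phi 0 c - \sum_(i < n.+1) phi i 0 / i`!%:R * c ^+ i).
Proof.
move=> dphi cphi phig.
(* Derivatives of x |-> phi 0 (c x), which carry the formula from [0, 1] to an increment c of any
   sign. *)
pose psi i x := c ^+ i * phi i (c * x + 0).
have dpsi i x : (i < n)%N -> is_derive x (1 : R) (psi i) (psi i.+1 x).
  move=> ilt; have H := @is_derive_comp_affine _ (phi i) (phi i.+1) c 0 x (dphi _ _ ilt).
  have := @is_deriveZ _ _ _ (fun t => phi i (c * t + 0)) (c ^+ i) x 1 _ H.
  by move=> K; apply: is_derive_eq K _; rewrite /psi exprSr -mulrA.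
have cpsi : continuous (psi n).
  have ca : continuous (fun x : R => c * x + 0).
    by move=> x; apply: cvgD; [apply: cvgM; [exact: cvg_cst|exact: cvg_id]|exact: cvg_cst].
  move=> x; apply: cvgM; first exact: cvg_cst.
  exact: (@continuous_comp _ _ _ (fun x : R => c * x + 0) (phi n) x (ca x) (cphi _)).
have psig : RN (psi n) (fun x => c ^+ n * (c * g (c * x + 0))).
  exact/RN_scale/RN_comp_affine.
have := RN_taylor1 dpsi cpsi psig.
have -> : psi 0 1 - \sum_(i < n.+1) psi i 0 / i`!%:R =
    phi 0 c - \sum_(i < n.+1) phi i 0 / i`!%:R * c ^+ i.
  rewrite /psi mulr1 addr0 expr0 mul1r; congr (_ - _).
  by apply: eq_bigr => i _; rewrite mulr0 addr0; ring.
move=> <-.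
under [RHS]eq_Rintegral => s _ do
  rewrite addr0 (mulrA (c ^+ n)) -exprSr mulrCA.
pose G1 (s : R) := (1 - s) ^+ n * g (c * s).
rewrite -[in LHS]/G1 -[in RHS]/G1 RintegralZl//; rewrite /G1.
(* What remains is integrability. For c = 0 the integrand is a polynomial in s; otherwise [psig]
   gives it, after division by c ^ (n + 1). *)
have [c0|c0] := eqVneq c 0.
  apply: continuous_itv_integrable.
  have -> : (fun s => (1 - s) ^+ n * g (c * s)) = (fun s => g 0 * (1 - s) ^+ n).
    by apply/funext => s; rewrite c0 mul0r mulrC.
  exact: continuous_onem_pow.
have [gi _] := RN_scale (c ^- n.+1) psig ler01.
pose gc x := c ^- n.+1 * (c ^+ n * (c * g (c * x + 0))).
have gci : mu.-integrable setT (EFin \o (gc \_ `[0, 1])).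
  by move/(integrable_mkcond _ _) : gi => /(_ (measurable_itv _)); rewrite restrict_EFin.
apply: eq_integrable (integrable_mul_dilation 1 0 1 (@continuous_onem_exp _ n) gci) => // s s01.
rewrite /= mul1r patchE s01 /gc addr0; congr (_ * _)%:E.
by rewrite (mulrA (c ^+ n)) -exprSr mulrA mulVf ?mul1r// expf_neq0.
Qed.

(** [q] is an integrable stand-in for [g], which is only locally integrable: the kernel evaluates it
    at a s v, of absolute value at most a, where the two agree. *)
Lemma remainder_kernel_taylor (phi : nat -> R -> R) (n : nat) (g q F : R -> R)
    (a : R) : 0 < a ->
  (forall i x, (i < n)%N -> is_derive x (1 : R) (phi i) (phi i.+1 x)) ->
  continuous (phi n) -> continuous (phi 0) -> RN (phi n) g ->
  (forall x, is_derive x (1 : R) F (phi 0 x)) ->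
  mu.-integrable setT (EFin \o q) -> {in `[- a, a], g =1 q} ->
  a ^+ n.+2 * \int[(mu \x mu)%E]_sv remainder_kernel a n q sv =
  n`!%:R * (F a - F (- a) - \sum_(i < n.+1) phi i 0 / i`!%:R *
    (a ^+ i.+1 - (- a) ^+ i.+1) / i.+1%:R).
Proof.
move=> a0 dphi cphi cphi0 phig FP qi gq.
(* Of the n + 2 factors a, n + 1 complete [v ^+ n.+1] to the power (a v) ^ (n + 1) of [RN_taylor];
   the last one belongs to the substitution x = a v in the integral over v. *)
rewrite Rintegral_remainder_kernel_vs ?gt_eqF// exprSr.
pose P v := phi 0 (a * v) - \sum_(i < n.+1) phi i 0 / i`!%:R * (a * v) ^+ i.
have -> : \int[mu]_(v in `[-1, 1]) (v ^+ n.+1 *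
    \int[mu]_(s in `[0, 1]) ((1 - s) ^+ n * q (a * v * s))) =
  \int[mu]_(v in `[-1, 1]) (n`!%:R / a ^+ n.+1 * P v).
  apply: eq_Rintegral => v; rewrite inE/= in_itv/= => /andP[v1 v1'].
  have an0 : a ^+ n.+1 != 0 by rewrite expf_neq0// gt_eqF.
  apply: (mulfI an0); rewrite mulrA -exprMn.
  have -> : \int[mu]_(s in `[0, 1]) ((1 - s) ^+ n * q (a * v * s)) =
      \int[mu]_(s in `[0, 1]) ((1 - s) ^+ n * g (a * v * s)).
    apply: eq_Rintegral => s; rewrite inE/= in_itv/= => /andP[s0 s1].
    rewrite gq// in_itv/= -ler_norml !normrM (gtr0_norm a0) -mulrA.
    apply: ler_piMr; first exact: ltW.
    by rewrite mulr_ile1// ler_norml ?v1//; apply/andP; split; lra.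
  rewrite (RN_taylor (a * v) dphi cphi phig).
  by rewrite -/(P v) mulrA mulrCA divff// mulr1.
pose H v := F (a * v + 0) - \sum_(i < n.+1) phi i 0 / i`!%:R * a ^+ i.+1 / i.+1%:R * v ^+ i.+1.
have HP v : is_derive v (1 : R) H (a * P v).
  have H1 := @is_derive_comp_affine _ F (phi 0) a 0 v (FP _).
  have := @is_derive_sum R R R n.+1 (fun (i : 'I_n.+1) (v : R) =>
      phi i 0 / i`!%:R * a ^+ i.+1 / i.+1%:R * v ^+ i.+1) v 1 _
    (fun i => is_derive_monomial _ i.+1 v).
  have -> : (\sum_(i < n.+1) (fun v => phi i 0 / i`!%:R * a ^+ i.+1 / i.+1%:R * v ^+ i.+1)) =
      fun v => \sum_(i < n.+1) phi i 0 / i`!%:R * a ^+ i.+1 / i.+1%:R * v ^+ i.+1.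
    by apply/funext => u; rewrite fct_sumE.
  move=> H2; have := is_deriveB H1 H2.
  move=> H3; apply: is_derive_eq H3 _.
  rewrite /P addr0 mulrBr mulr_sumr; congr (_ - _); apply: eq_bigr => i _.
  rewrite /= exprMn exprS; field.
  by rewrite addrC natr1 !pnatr_eq0 -lt0n fact_gt0.
have cP : continuous (fun v => a * P v).
  have ca : continuous (fun x : R => a * x).
    by move=> x; apply: cvgM; [exact: cvg_cst|exact: cvg_id].
  move=> v; apply: cvgM; first exact: cvg_cst.
  apply: cvgB; first exact: (@continuous_comp _ _ _ ( *%R a) (phi 0) v (ca v) (cphi0 _)).
  apply: cvg_big => [|i _]; first exact: add_continuous.
  apply: cvgM; first exact: cvg_cst.
  exact: (@continuous_comp _ _ _ ( *%R a) (fun x => x ^+ i) v (ca v) (@exprn_continuous _ _ _)).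
have RNH := RN_is_derive HP cP.
have [_ HE] : mu.-integrable `[-1, 1] (EFin \o _) /\ _ := RNH (-1) 1 ltac:(lra).
have Pi : mu.-integrable `[-1, 1] (EFin \o P).
  apply: continuous_itv_integrable.
  have -> : P = (fun v => a^-1 * (a * P v)).
    by apply/funext => v; rewrite mulrA mulVf ?mul1r// gt_eqF.
  by move=> v; apply: cvgM; [exact: cvg_cst|exact: cP].
rewrite RintegralZl// in HE *.
rewrite RintegralZl//.
have -> : a ^+ n.+1 * a * (n`!%:R / a ^+ n.+1 * \int[mu]_(x in `[-1, 1]) P x) =
   n`!%:R * (a * \int[mu]_(x in `[-1, 1]) P x).
  have : a ^+ n.+1 != 0 by rewrite expf_neq0// gt_eqF.
  by move: (a ^+ n.+1) => y y0; field.
rewrite HE /H mulr1 mulrN1 !addr0; congr (_ * _).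
rewrite opprD addrACA -opprD; congr (_ - _); rewrite -sumrB.
apply: eq_bigr => i _; rewrite expr1n mulr1 [(- a) ^+ _]exprNn.
ring.
Qed.

End Taylor_remainder_identity.

(** * Uniform limits and finite sums under the integral *)

Section uniform_limits.
Context {R : realType}.
Local Notation mu := (@lebesgue_measure R).
Local Notation mu2 := (mu \x mu)%E.

Lemma uniform_cvg_near (A : set R) (S : nat -> R -> R) (h : R -> R) :
  {uniform A, S @ \oo --> h} -> forall e, 0 < e ->
  \forall n \near \oo, forall x, A x -> `|h x - S n x| < e.
Proof.
move=> Sh e e0; apply: (Sh [set u | forall x, A x -> `|h x - u x| < e]).
apply/uniform_nbhs; exists [set xy : R * R | ball xy.1 e xy.2].
by split; first exact: (@entourage_ball R R (PosNum e0)).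
Qed.

(** A single S n within distance 1 of h on A gives the integrable majorant |S n| + 1; the constant
    is integrable because A has finite measure. *)
Lemma integrable_uniform_limit (A : set R) (S : nat -> R -> R) (h : R -> R) :
  measurable A -> (mu A < +oo)%E ->
  (forall n, mu.-integrable A (EFin \o S n)) ->
  {uniform A, S @ \oo --> h} -> mu.-integrable A (EFin \o h).
Proof.
move=> mA Aoo Si Sh.
have mh : measurable_fun A h.
  apply: (measurable_fun_cvg (h := S)) => [n|x Ax].
    by have /measurable_EFinP := measurable_int _ (Si n).
  apply/cvgrPdist_lt => e /(uniform_cvg_near Sh); apply: filterS => n; exact.
have [n _ /(_ n (leqnn n)) hS] := uniform_cvg_near Sh ltr01.
pose b x := `|S n x| + 1.
have bi : mu.-integrable A (EFin \o b).
  have i1 : mu.-integrable A (EFin \o cst 1).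
    apply: measurable_bounded_integrable => //.
    by exists 1; split=> // M M1 x _; rewrite /= normr1 ltW.
  have Ni : mu.-integrable A (EFin \o (fun x => `|S n x|)) := integrable_norm (Si n).
  have := @integrableD _ _ _ mu A mA _ _ Ni i1.
  by apply: eq_integrable.
apply: le_integrable bi => //; first exact/measurable_EFinP.
move=> x Ax; rewrite /= lee_fin /b (le_trans _ (ler_norm _))//.
rewrite -lerBlDl (le_trans _ (ltW (hS x Ax)))//.
exact: lerB_dist.
Qed.

Lemma Rintegral_remainder_kernel_cvg (A : set R) (S : nat -> R -> R) (h : R -> R)
    (a : R) (n : nat) : a != 0 -> measurable A -> (mu A < +oo)%E ->
  (forall k, mu.-integrable A (EFin \o S k)) -> {uniform A, S @ \oo --> h} ->
  \int[mu2]_sv remainder_kernel a n (S k \_ A) sv @[k --> \oo] -->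
    \int[mu2]_sv remainder_kernel a n (h \_ A) sv.
Proof.
move=> a0 mA Aoo Si Sh.
have patchi (u : R -> R) : mu.-integrable A (EFin \o u) ->
    mu.-integrable setT (EFin \o (u \_ A)).
  move=> ui; have := (@integrable_mkcond _ _ _ mu _ _ mA).1 ui.
  by rewrite restrict_EFin.
have hi := patchi _ (integrable_uniform_limit mA Aoo Si Sh).
apply/cvgrPdist_le => e e0; have e20 : 0 < e / 2 by rewrite divr_gt0.
apply: filterS (uniform_cvg_near Sh e20) => k hS.
apply: (le_trans (@Rintegral_remainder_kernel_close _ _ n _ _ (e / 2) a0 hi (patchi _ (Si k)) _)).
  move=> x; rewrite !patchE; case: ifPn => [|_]; first by rewrite inE => /hS/ltW.
  by rewrite subrr normr0 ltW.
by rewrite mulrC divfK.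
Qed.

Lemma Rintegral_sum_seq d (T : measurableType d) (nu : {measure set T -> \bar R})
    (D : set T) (s : seq nat) (u : nat -> T -> R) : measurable D ->
  (forall j, j \in s -> nu.-integrable D (EFin \o u j)) ->
  nu.-integrable D (EFin \o (fun x => \sum_(j <- s) u j x)) /\
  \int[nu]_(x in D) (\sum_(j <- s) u j x) = \sum_(j <- s) \int[nu]_(x in D) u j x.
Proof.
move=> mD; elim: s => [_|i s IH ui].
  split.
    apply: eq_integrable (integrable0 _ _) => // x _.
    by rewrite /= big_nil.
  rewrite big_nil (@eq_Rintegral _ _ _ _ _ (cst 0)) => [|x _]; last by rewrite big_nil.
  by rewrite Rintegral_cst//= mul0r.
have [Si Se] := IH (fun j js => ui j (mem_behead (s := i :: s) js)).
have uii := ui i (mem_head _ _).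
split.
  apply: eq_integrable (integrableD mD uii Si) => // x _.
  by rewrite /= big_cons.
under eq_Rintegral => x _ do rewrite big_cons.
by rewrite RintegralD// Se big_cons.
Qed.

(** The left side has the shape of [remainder_infty], with v innermost and the sum over j inside.
    Combined with [Rintegral_remainder_kernel_vs] this performs the exchange of the two
    integrals. *)
Lemma Rintegral_remainder_kernel_sum (n m : nat) (A : nat -> R) (q : R -> R) :
  mu.-integrable setT (EFin \o q) ->
  \int[mu]_(s in `[0, 1]) ((1 - s) ^+ n * \int[mu]_(v in `[-1, 1]) (v ^+ n.+1 *
    \sum_(1 <= j < m) (A j * q (j%:R * s * v / 2)))) =
  \sum_(1 <= j < m) A j * \int[mu2]_sv remainder_kernel (j%:R / 2) n q sv.
Proof.
move=> qi; pose r := index_iota 1 m.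
have ki j : j \in r -> mu2.-integrable setT (EFin \o remainder_kernel (j%:R / 2) n q).
  rewrite mem_index_iota => /andP[j1 _]; apply: integrable_remainder_kernel => //.
  by rewrite mulf_neq0// ?invr_eq0 ?pnatr_eq0// -lt0n.
pose u j sv := A j * remainder_kernel (j%:R / 2) n q sv.
have ui j : j \in r -> mu2.-integrable setT (EFin \o u j).
  move=> jr; have := @integrableZl _ _ _ mu2 _ measurableT (A j) _ (ki j jr).
  by apply: eq_integrable.
have [ki' kE] := Rintegral_sum_seq measurableT ui.
have -> : \sum_(1 <= j < m) A j * \int[mu2]_sv remainder_kernel (j%:R / 2) n q sv =
    \int[mu2]_sv \sum_(j <- r) u j sv.
  by rewrite kE big_seq [RHS]big_seq; apply: eq_bigr => j jr; rewrite RintegralZl// ki.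
rewrite -(Rintegral12_prod ki') Rintegral_mkcond; apply: eq_Rintegral => s _.
rewrite patchE; case: ifPn => s01; last first.
  rewrite (@eq_Rintegral _ _ _ _ _ (cst 0)) ?Rintegral_cst ?mul0r// => v _.
  rewrite big1// => j _; rewrite /u /remainder_kernel/= patchE (negbTE s01).
  by rewrite (_ : point = 0)// !mul0r mulr0.
rewrite -RintegralZl//.
  rewrite Rintegral_mkcond; apply: eq_Rintegral => v _; rewrite patchE.
  case: ifPn => v01; last first.
    rewrite big1// => j _; rewrite /u /remainder_kernel/= !patchE (negbTE v01).
    by rewrite (_ : point = 0)// mulr0 mul0r mulr0.
  rewrite mulrA mulr_sumr; apply: eq_bigr => j _.
  rewrite /u /remainder_kernel/= !patchE s01 v01 mulrCA; congr (_ * (_ * q _)).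
  by ring.
pose w j v := A j * (v ^+ n.+1 * q (j%:R * s / 2 * v)).
have wi j : j \in r -> mu.-integrable `[-1, 1] (EFin \o w j).
  move=> _; have := @integrableZl _ _ _ mu _ (measurable_itv `[-1, 1]) (A j) _
    (integrable_mul_dilation (j%:R * s / 2) (-1) 1 (@exprn_continuous _ n.+1) qi).
  by apply: eq_integrable.
have [wi' _] := @Rintegral_sum_seq _ _ mu `[-1, 1]%classic r w (measurable_itv _) wi.
apply: eq_integrable wi' => // v _; rewrite /= mulr_sumr; congr _%:E.
by apply: eq_bigr => j _; rewrite /w mulrCA; congr (_ * (_ * q _)); ring.
Qed.

End uniform_limits.

(** * The remainder formula for finite sums *)

Section partial_sums.
Context {R : realType}.
Local Notation mu := (@lebesgue_measure R).
Local Notation mu2 := (mu \x mu)%E.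
Local Notation RN := (@is_Radon_Nikodym_derivative R).

Lemma is_derive_sum_shift (K : nat) (f df : R -> R) (x : R) :
  (forall x, is_derive x (1 : R) f (df x)) ->
  is_derive x (1 : R) (fun x => \sum_(0 <= k < K) f (1 * x + k%:R))
    (\sum_(0 <= k < K) df (1 * x + k%:R)).
Proof.
move=> fdf.
have H := @is_derive_sum R R R K (fun (k : 'I_K) (x : R) => f (1 * x + k%:R)) x 1 _
  (fun k => is_derive_comp_affine (fdf (1 * x + k%:R))).
rewrite big_mkord.
have -> : (fun x => \sum_(0 <= k < K) f (1 * x + k%:R)) =
    \sum_(k < K) (fun x => f (1 * x + k%:R)).
  by apply/funext => u; rewrite fct_sumE big_mkord.
by apply: is_derive_eq H _; apply: eq_bigr => k _; rewrite mul1r.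
Qed.

Lemma continuous_sum_shift (K : nat) (f : R -> R) : continuous f ->
  continuous (fun x : R => \sum_(0 <= k < K) f (1 * x + k%:R)).
Proof.
move=> cf; apply: continuous_big => [|k _ x]; first exact: add_continuous.
have ca : {for x, continuous (fun x : R => 1 * x + k%:R)}.
  by apply: cvgD; [apply: cvgM; [exact: cvg_cst|exact: cvg_id]|exact: cvg_cst].
exact: (@continuous_comp _ _ _ (fun x : R => 1 * x + k%:R) f x ca (cf _)).
Qed.

Lemma sum_G_step (m n : nat) (F : R -> R) :
  \sum_(1 <= j < m.+1) gamma_coef R m j *
    (\sum_(0 <= k < n) F (1 * (j%:R / 2) + k%:R) -
     \sum_(0 <= k < n) F (1 * - (j%:R / 2) + k%:R)) = G m F n - G m F 0.
Proof.
under eq_bigr => j _ do rewrite -sumrB mulr_sumr.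
rewrite exchange_big/= -(telescope_sumr (G m F))//.
apply: eq_bigr => k _; rewrite G_step; apply: eq_bigr => j _.
by congr (_ * (F _ - F _)); rewrite mul1r addrC.
Qed.

(** Taylor's formula is applied to the sum over k as one function of the shift, not term by term, so
    that the partial sums of [g] stand inside the kernel, where uniform convergence can act on
    them. *)
Lemma partial_sum_remainder (m n K : nat) (phi : nat -> R -> R) (g F : R -> R) :
  (2 * m = n.+1)%N ->
  (forall i x, (i < n)%N -> is_derive x (1 : R) (phi i) (phi i.+1 x)) ->
  (forall i, (i <= n)%N -> continuous (phi i)) -> RN (phi n) g ->
  (forall x, is_derive x (1 : R) F (phi 0 x)) ->
  \sum_(0 <= k < K) phi 0 k%:R = G m F K - G m F 0 - 1 / (n`!%:R * 2 ^+ n.+2) *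
    \sum_(1 <= j < m.+1) gamma_coef R m j * j%:R ^+ n.+2 *
      \int[mu2]_sv remainder_kernel (j%:R / 2) n
        ((fun w => \sum_(0 <= k < K) g (k%:R + w)) \_ `[- (m%:R / 2), m%:R / 2]) sv.
Proof.
move=> mn dphi cphi phig FP.
(* The factors 1 here and in [gK] keep the affine form c * x + d of the composition lemmas. *)
pose psi i x := \sum_(0 <= k < K) phi i (1 * x + k%:R).
pose FK x := \sum_(0 <= k < K) F (1 * x + k%:R).
pose S w := \sum_(0 <= k < K) g (k%:R + w).
pose gK x := \sum_(0 <= k < K) (1 * g (1 * x + k%:R)).
have SE : S = gK.
  by apply/funext => x; apply: eq_bigr => k _; rewrite !mul1r addrC.
have psig : RN (psi n) gK.
  by apply: (@RN_sum _ K (fun k x => phi n (1 * x + k%:R))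
    (fun k x => 1 * g (1 * x + k%:R))) => k; exact: RN_comp_affine.
have mm : - (m%:R / 2) <= m%:R / 2 :> R by have : 0 <= m%:R :> R by []; lra.
have qi : mu.-integrable setT (EFin \o (S \_ `[- (m%:R / 2), m%:R / 2])).
  have [Si _] := psig _ _ mm; rewrite SE.
  have := (@integrable_mkcond _ _ _ mu _ _ (measurable_itv _)).1 Si.
  by rewrite restrict_EFin.
set I := fun j => \int[mu2]_sv remainder_kernel (j%:R / 2) n
  (S \_ `[- (m%:R / 2), m%:R / 2]) sv.
have kT j : (0 < j <= m)%N -> (j%:R / 2) ^+ n.+2 * I j =
    n`!%:R * (FK (j%:R / 2) - FK (- (j%:R / 2)) - \sum_(i < n.+1) psi i 0 / i`!%:R *
    ((j%:R / 2) ^+ i.+1 - (- (j%:R / 2)) ^+ i.+1) / i.+1%:R).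
  move=> /andP[j0 jm]; apply: (@remainder_kernel_taylor _ psi n gK _ FK) => //.
  - by rewrite divr_gt0// ltr0n.
  - by move=> i x iN; apply: is_derive_sum_shift => y; exact: dphi.
  - exact/continuous_sum_shift/cphi.
  - exact/continuous_sum_shift/cphi.
  - by move=> x; exact: is_derive_sum_shift.
  move=> x; rewrite in_itv/= => /andP[x1 x2]; rewrite -SE patchE mem_set//=.
  have : j%:R <= m%:R :> R by rewrite ler_nat.
  by rewrite in_itv/= => jm'; apply/andP; split; lra.
have n0 : n`!%:R != 0 :> R by rewrite pnatr_eq0 -lt0n fact_gt0.
have -> : 1 / (n`!%:R * 2 ^+ n.+2) *
    \sum_(1 <= j < m.+1) gamma_coef R m j * j%:R ^+ n.+2 * I j =
  \sum_(1 <= j < m.+1) gamma_coef R m j * (FK (j%:R / 2) - FK (- (j%:R / 2)) -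
    \sum_(i < n.+1) psi i 0 / i`!%:R *
    ((j%:R / 2) ^+ i.+1 - (- (j%:R / 2)) ^+ i.+1) / i.+1%:R).
  rewrite mulr_sumr big_nat [RHS]big_nat; apply: eq_bigr => j jm.
  apply: (mulfI n0); rewrite [RHS]mulrCA -kT// expr_div_n.
  have t0 : 2 ^+ n.+2 != 0 :> R by rewrite expf_neq0.
  by move: (2 ^+ n.+2) t0 (I j) => t t0 y; field; rewrite t0 n0.
under [in RHS]eq_bigr => j _ do rewrite mulrBr.
rewrite sumrB sum_G_step opprB [RHS]addrC subrK.
(* The orders i <= n are exactly those below 2m, where the weights annihilate every difference but
   that of i = 0. *)
have -> : \sum_(1 <= j < m.+1) gamma_coef R m j *
    (\sum_(i < n.+1) psi i 0 / i`!%:R *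
      ((j%:R / 2) ^+ i.+1 - (- (j%:R / 2)) ^+ i.+1) / i.+1%:R) =
  \sum_(i < n.+1) psi i 0 / i`!%:R / i.+1%:R * (i == 0 :> nat)%:R.
  under eq_bigr => j _ do rewrite mulr_sumr.
  rewrite exchange_big/=; apply: eq_bigr => i _.
  rewrite -(@gamma_odd_difference R m); last by rewrite mn.
  by rewrite mulr_sumr; apply: eq_bigr => j _; ring.
rewrite [RHS]big_ord_recl/= [X in _ + X]big1 ?addr0 => [|i _]; last by rewrite mulr0.
rewrite !divr1 mulr1 /psi; apply: eq_bigr => k _.
by rewrite mulr0 add0r.
Qed.

End partial_sums.

(** * Passage to the limit in the number of terms *)

Theorem proposition5p1 (R : realType) (m0 m : nat) (hm0 : (1 <= m0)%N)
  (hm : (m0 <= m)%N) (f f2m F : R -> R)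
  (hf : C_minus (2 * m) f)
  (hf2m : is_Radon_Nikodym_derivative (derive1n (2 * m).-1 f) f2m)
  (hf0 : derive1n (2 * m0).-1 f x @[x --> +oo] --> (0 : R))
  (hunif : exists h : R -> R,
    {uniform `[- (m%:R / 2), m%:R / 2],
      (fun (n : nat) (w : R) => \sum_(0 <= k < n) f2m (k%:R + w)) @ \oo --> h})
  (hF : forall x : R, is_derive x (1 : R) F (f x)) :
  [/\ forall n : nat, G m F n = G_tau m F n /\ G m F n = G_tau_sym m F n,
      forall n : nat, G m0 F n = G_tau m0 F n /\ G m0 F n = G_tau_sym m0 F n,
      cvgn (alt_partial_sum m0 f F)
    & alt_sum m0 f F = - G m F 0 - remainder_infty m f2m].
Proof.
have m_gt0 : (0 < m)%N by exact: leq_trans hm0 hm.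
pose n := (2 * m).-1; have mn : (2 * m = n.+1)%N by rewrite /n; lia.
pose C : R := 1 / (n`!%:R * 2 ^+ n.+2).
case: hf => fd fc _; have [h hunifh] := hunif.
pose phi i := derive1n i f.
have dphi i x : (i < n)%N -> is_derive x (1 : R) (phi i) (phi i.+1 x).
  by move=> ilt; rewrite /phi derive1nS derive1E; apply/derivableP/fd; lia.
have cphi i : (i <= n)%N -> continuous (phi i) by move=> ilt; apply: fc; lia.
pose K := `[- (m%:R / 2), m%:R / 2]%classic : set R.
have mK : measurable K by exact: measurable_itv.
pose S (k : nat) (w : R) := \sum_(0 <= i < k) f2m (i%:R + w).
have Si k : (@lebesgue_measure R).-integrable K (EFin \o S k).
  have mm : - (m%:R / 2) <= m%:R / 2 :> R by have : 0 <= m%:R :> R by []; lra.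
  have [+ _] := @RN_sum _ k (fun i x => phi n (1 * x + i%:R))
    (fun i x => 1 * f2m (1 * x + i%:R)) (fun i => RN_comp_affine 1 i%:R hf2m) _ _ mm.
  by apply: eq_integrable => // x _; congr _%:E; apply: eq_bigr => i _;
    rewrite !mul1r addrC.
have Koo : (@lebesgue_measure R K < +oo)%E.
  by rewrite /K lebesgue_measure_itv/=; case: ifPn => _ //; rewrite -EFinB ltry.
(* The remainder as a functional of [q], without the constant [C]. It is evaluated at the cut-off
   partial sums and at their cut-off limit. *)
pose E q := \sum_(1 <= j < m.+1) gamma_coef R m j * j%:R ^+ n.+2 *
  \int[(lebesgue_measure \x lebesgue_measure)%E]_sv remainder_kernel (j%:R / 2) n q sv.
have Ecvg : E (S k \_ K) @[k --> \oo] --> E (h \_ K).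
  (* The bound 1 <= j is kept in the sum because the kernel lemmas need j / 2 to be nonzero. *)
  rewrite /E; under eq_cvg do rewrite big_nat_cond; rewrite big_nat_cond.
  apply: cvg_big => [|j /andP[/andP[j1 _] _]]; first exact: add_continuous.
  apply: cvgM; first exact: cvg_cst.
  apply: Rintegral_remainder_kernel_cvg => //.
  by rewrite mulf_neq0// ?invr_eq0 ?pnatr_eq0// -lt0n.
have sumE k : \sum_(0 <= i < k) f i%:R = G m F k - G m F 0 - C * E (S k \_ K).
  exact: (@partial_sum_remainder R m n k phi f2m F mn dphi cphi hf2m hF).
have remE : remainder_infty m f2m = C * E (h \_ K).
  have hi : (@lebesgue_measure R).-integrable setT (EFin \o (h \_ K)).
    have hi : (@lebesgue_measure R).-integrable K (EFin \o h).
      exact: (integrable_uniform_limit mK Koo Si hunifh).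
    have := (@integrable_mkcond _ _ _ lebesgue_measure _ _ mK).1 hi.
    by rewrite restrict_EFin.
  rewrite /E -(Rintegral_remainder_kernel_sum _ _ _ hi) /remainder_infty mn.
  rewrite -/C; congr (_ * _); apply: eq_Rintegral => s; rewrite inE/= in_itv/= => s01.
  congr (_ * _); apply: eq_Rintegral => v; rewrite inE/= in_itv/= => v01.
  congr (_ * _); rewrite big_nat [RHS]big_nat; apply: eq_bigr => j /andP[_ jm].
  congr (_ * _).
  (* This point lies in [K], where the uniform limit [h] is also the pointwise limit denoted by
     [limn]. *)
  set x := j%:R * s * v / 2.
  have xK : K x.
    rewrite /K/= in_itv/= -ler_norml /x !normrM [`|2^-1|]ger0_norm// ler_pM2r//.
    have jm' : j%:R <= m%:R :> R by rewrite ler_nat.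
    rewrite -[leRHS]mulr1 -mulrA; apply: ler_pM; [by []|by rewrite mulr_ge0|by rewrite normr_nat|].
    have [s0 s1] := andP s01.
    by apply: mulr_ile1; rewrite ?normr_ge0// ler_norml//; apply/andP; lra.
  rewrite patchE mem_set//; apply/cvg_lim => //.
  apply/cvgrPdist_lt => e /(uniform_cvg_near hunifh); apply: filterS => k /(_ _ xK).
  by rewrite /series/=.
(* With F put in front as index 0, all orders shift by one: index 2 m0 is the derivative of f of
   order 2 m0 - 1, which tends to 0 by hypothesis. *)
have Gcvg := @G_sub_cvg0 R m0 m (fun i => if i is i'.+1 then phi i' else F) hm.
have {}Gcvg : (G m F k - G m0 F k) @[k --> \oo] --> (0 : R).
  apply: Gcvg.
    move=> [|i] x ilt; first exact: hF.
    by apply: dphi; lia.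
  by case: (m0) hm0 hf0 => // k _; rewrite mulnS.
have cvgL : alt_partial_sum m0 f F @ \oo --> - G m F 0 - remainder_infty m f2m.
  have -> : alt_partial_sum m0 f F =
      fun k => (G m F k - G m0 F k) + (- G m F 0 - C * E (S k \_ K)).
    by apply/funext => k; rewrite /alt_partial_sum sumE; ring.
  rewrite -[X in _ --> X]add0r remE; apply: cvgD; first exact: Gcvg.
  apply: cvgB; first exact: cvg_cst.
  by apply: cvgM; [exact: cvg_cst|exact: Ecvg].
split.
- by move=> k; rewrite -G_tauE// -G_tau_symE.
- by move=> k; rewrite -G_tauE// -G_tau_symE.
- by apply/cvg_ex; eexists; exact: cvgL.
- by rewrite /alt_sum; apply/cvg_lim.
Qed.
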